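(* The exponential generating function of the sequence $\{|B_{SO(2\ell-1)}\backslash\mathcal{B}_{\mathfrak{so}(2\ell)}|\}_{\ell\ge 0}$ is $e^{\frac{x}{1-2x}}$; that is, as formal power series, $$\sum_{\ell\ge 0}\frac{|B_{SO(2\ell-1)}\backslash\mathcal{B}_{\mathfrak{so}(2\ell)}|}{\ell!}x^\ell=e^{\frac{x}{1-2x}}.$$
   Context: Over $\mathbb{C}$: $SO(2\ell)$ is the group of determinant-one linear maps of $\mathbb{C}^{2\ell}$ preserving the symmetric bilinear form $\beta$ with $\beta(e_j,e_k)=\delta_{j,-k}$, where $e_1,\dots,e_\ell,e_{-\ell},\dots,e_{-1}$ is an ordered basis of $\mathbb{C}^{2\ell}$. $\mathcal{B}_{\mathfrak{so}(2\ell)}$ is the flag variety of $\mathfrak{so}(2\ell)$ (variety of Borel subalgebras). $SO(2\ell-1)\subset SO(2\ell)$ is the subgroup fixing $e_\ell-e_{-\ell}$, and $B_{SO(2\ell-1)}$ is the intersection of $SO(2\ell-1)$ with the group of upper triangular matrices with respect to the ordered basis above; it is a Borel subgroup of $SO(2\ell-1)$. $H\backslash X$ denotes the set of $H$-orbits on $X$. By convention the term for $\ell=0$ equals $1$. The exponential generating function of a sequence $f(\ell)$, $\ell\ge0$, is $\sum_{\ell\ge0}\frac{f(\ell)}{\ell!}x^\ell$. *)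

(* Defs.v *)
From HB Require Import structures.
From mathcomp Require Import all_boot all_order all_algebra.
From mathcomp Require Import all_classical all_reals.
From mathcomp Require Export finmap complex.

Set Implicit Arguments.
Unset Strict Implicit.
Unset Printing Implicit Defensive.

Import GRing.Theory.

Local Open Scope ring_scope.
Local Open Scope classical_set_scope.

(* Power series over the rationals, as coefficient sequences; the ring structure
   below has the Cauchy product, not the pointwise one. *)
Record fps := Fps { fps_coef : nat -> rat }.

HB.instance Definition _ := [isNew for fps_coef].
HB.instance Definition _ := [Choice of fps by <:].

Lemma fpsP (a b : fps) : fps_coef a =1 fps_coef b <-> a = b.
Proof.
split=> [|-> //]; case: a b => [a] [b] /= ab.
by congr Fps; apply/funext.
Qed.

Definition fps_zero := Fps (fun=> 0).
Definition fps_opp a := Fps (fun n => - fps_coef a n).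
Definition fps_add a b := Fps (fun n => fps_coef a n + fps_coef b n).
Definition fps_one := Fps (fun n => (n == 0%N)%:R).
Definition fps_mul a b :=
  Fps (fun n => \sum_(i < n.+1) fps_coef a i * fps_coef b (n - i)).

Fact fps_addA : associative fps_add.
Proof. by move=> a b c; apply/fpsP=> n /=; rewrite addrA. Qed.
Fact fps_addC : commutative fps_add.
Proof. by move=> a b; apply/fpsP=> n /=; rewrite addrC. Qed.
Fact fps_add0 : left_id fps_zero fps_add.
Proof. by move=> a; apply/fpsP=> n /=; rewrite add0r. Qed.
Fact fps_addN : left_inverse fps_zero fps_opp fps_add.
Proof. by move=> a; apply/fpsP=> n /=; rewrite addNr. Qed.

HB.instance Definition _ :=
  GRing.isZmodule.Build fps fps_addA fps_addC fps_add0 fps_addN.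

Definition fps_trunc (m : nat) (a : fps) : {poly rat} :=
  \poly_(i < m) fps_coef a i.

Lemma fps_mul_trunc m n a b : (n < m)%N ->
  fps_coef (fps_mul a b) n = (fps_trunc m a * fps_trunc m b)`_n.
Proof.
move=> nm; rewrite coefM; apply: eq_bigr => i _.
rewrite !coef_poly (leq_ltn_trans (leq_subr _ _) nm).
by rewrite (leq_ltn_trans _ nm) // -ltnS.
Qed.

Lemma fps_mul_truncl m n a (p : {poly rat}) b : (n < m)%N ->
    (forall i, (i < m)%N -> p`_i = fps_coef a i) ->
  (p * fps_trunc m b)`_n = (fps_trunc m a * fps_trunc m b)`_n.
Proof.
move=> nm pa; rewrite !coefM; apply: eq_bigr => i _.
have im : (i < m)%N by rewrite (leq_ltn_trans _ nm) // -ltnS.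
by rewrite pa // !coef_poly im.
Qed.

Fact fps_mulC : commutative fps_mul.
Proof.
by move=> a b; apply/fpsP=> n; rewrite !(fps_mul_trunc _ _ (ltnSn n)) mulrC.
Qed.

Fact fps_mulA : associative fps_mul.
Proof.
have mulE n a b c : fps_coef (fps_mul (fps_mul a b) c) n =
    (fps_trunc n.+1 a * fps_trunc n.+1 b * fps_trunc n.+1 c)`_n.
  rewrite (fps_mul_trunc _ _ (ltnSn n)).
  apply/esym/fps_mul_truncl => // i im.
  by rewrite (fps_mul_trunc _ _ im).
move=> a b c; apply/fpsP=> n; rewrite fps_mulC !mulE.
by rewrite mulrC mulrA.
Qed.

Fact fps_mul1 : left_id fps_one fps_mul.
Proof.
move=> a; apply/fpsP=> n /=; rewrite big_ord_recl /= mul1r subn0.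
by rewrite big1 ?addr0 // => i _; rewrite mul0r.
Qed.

Fact fps_mulDl : left_distributive fps_mul fps_add.
Proof.
move=> a b c; apply/fpsP=> n /=; rewrite -big_split /=.
by apply: eq_bigr => i _; rewrite mulrDl.
Qed.

Fact fps_one_neq0 : fps_one != fps_zero.
Proof. by apply/eqP=> /fpsP /(_ 0%N) /eqP; rewrite /= oner_eq0. Qed.

HB.instance Definition _ := GRing.Zmodule_isComNzRing.Build fps
  fps_mulA fps_mulC fps_mul1 fps_mulDl fps_one_neq0.

(* The first n coefficients of the inverse b of a series a, determined by
   a_0 b_m + sum_(i < m) a_(m - i) b_i = [m = 0]. *)
Fixpoint fps_inv_seq (a : fps) (n : nat) : seq rat :=
  if n is m.+1 then
    let s := fps_inv_seq a m in
    rcons s ((fps_coef a 0)^-1 *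
             ((m == 0%N)%:R - \sum_(i < m) s`_i * fps_coef a (m - i)))
  else [::].

Definition fps_unit : {pred fps} := fun a => fps_coef a 0 != 0.

Definition fps_inv (a : fps) : fps :=
  if fps_unit a then Fps (fun n => (fps_inv_seq a n.+1)`_n) else a.

Lemma size_fps_inv_seq a n : size (fps_inv_seq a n) = n.
Proof. by elim: n => //= n IH; rewrite size_rcons IH. Qed.

Lemma nth_fps_inv_seq a n i : (i < n)%N ->
  (fps_inv_seq a n)`_i = (fps_inv_seq a i.+1)`_i.
Proof.
elim: n => // n IH; rewrite ltnS leq_eqVlt => /predU1P[-> //|lt_in].
by rewrite [in LHS]/= nth_rcons size_fps_inv_seq lt_in IH.
Qed.

Fact fps_mulVr : {in fps_unit, left_inverse 1 fps_inv *%R}.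
Proof.
move=> a a0; have a0' : fps_coef a 0 != 0 := a0.
rewrite /fps_inv (_ : fps_unit a) //; apply/fpsP=> n.
rewrite [LHS]/= big_ord_recr /= subnn nth_rcons size_fps_inv_seq ltnn eqxx.
rewrite mulrAC mulVf // mul1r addrC -addrA -[RHS]addr0; congr (_ + _).
apply/eqP; rewrite addrC subr_eq0; apply/eqP/eq_bigr => i _; congr (_ * _).
by rewrite [RHS]nth_fps_inv_seq.
Qed.

Fact fps_unitPl a b : b * a = 1 -> fps_unit a.
Proof.
move/fpsP/(_ 0%N); rewrite /= big_ord1 => ba1.
by apply/eqP=> a0; move/eqP: ba1; rewrite a0 mulr0 eq_sym oner_eq0.
Qed.

Fact fps_inv_out : {in [predC fps_unit], fps_inv =1 id}.
Proof.
by move=> a; rewrite /fps_inv => /negPf na; rewrite (_ : fps_unit a = false).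
Qed.

HB.instance Definition _ :=
  GRing.ComNzRing_hasMulInverse.Build fps fps_mulVr fps_unitPl fps_inv_out.

Definition fpsX : fps := Fps (fun n => (n == 1%N)%:R).

(* e^a = sum_k a^k / k!, for a series a with zero constant term: in that case
   a^k only contributes to the coefficients of index n >= k, so the sum defining
   each coefficient is finite. *)
Definition fps_exp (a : fps) : fps :=
  Fps (fun n => \sum_(k < n.+1) fps_coef (a ^+ k) n / k`!%:R).

Definition egf (f : nat -> nat) : fps := Fps (fun n => (f n)%:R / n`!%:R).

Definition lie_bracket (F : fieldType) (n : nat) (A B : 'M[F]_n) : 'M[F]_n :=
  A *m B - B *m A.

Definition derived_alg (F : fieldType) (n : nat) (U : {vspace 'M[F]_n}) :
    {vspace 'M[F]_n} :=
  <<[seq lie_bracket A B | A <- vbasis U, B <- vbasis U]>>%VS.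

Lemma derived_algP (F : fieldType) (n : nat) (U V : {vspace 'M[F]_n}) :
  (derived_alg U <= V)%VS <->
  (forall A B, A \in U -> B \in U -> lie_bracket A B \in V).
Proof.
split=> [/span_subvP sUV A B AU BU|UV].
  have sumE (C : 'M[F]_n) : C \in U ->
      exists (a : 'I_(\dim U) -> F) (X : 'I_(\dim U) -> 'M[F]_n),
        (forall i, X i \in (vbasis U : seq _)) /\ C = \sum_i a i *: X i.
    move=> CU; exists (fun i => coord (vbasis U) i C), (fun i => (vbasis U)`_i).
    split=> [i|]; last exact: coord_vbasis CU.
    by apply/mem_nth; rewrite size_tuple.
  have [a [X [XU ->]]] := sumE A AU; have [b [Y [YU ->]]] := sumE B BU.
  rewrite /lie_bracket mulmx_suml mulmx_sumr -sumrB.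
  apply: memv_suml => i _; rewrite mulmx_suml mulmx_sumr -sumrB.
  apply: memv_suml => j _; rewrite -!scalemxAl -!scalemxAr !scalerA.
  rewrite [X in _ - X *: _]mulrC -scalerBr.
  by apply/memvZ/sUV/allpairs_f; [apply: XU|apply: YU].
apply/span_subvP=> _ /allpairsP[[A B] [/= AU BU ->]].
by apply: UV; apply: vbasis_mem.
Qed.

Definition lie_subalgebra (F : fieldType) (n : nat) (U : {vspace 'M[F]_n}) :=
  forall A B, A \in U -> B \in U -> lie_bracket A B \in U.

Definition lie_solvable (F : fieldType) (n : nat) (U : {vspace 'M[F]_n}) :=
  exists k : nat, iter k (@derived_alg F n) U = 0%VS.

Definition borel_subalgebra (F : fieldType) (n : nat)
    (g b : {vspace 'M[F]_n}) : Prop :=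
  [/\ (b <= g)%VS, lie_subalgebra b, lie_solvable b
    & forall c : {vspace 'M[F]_n}, (c <= g)%VS -> lie_subalgebra c ->
        lie_solvable c -> (b <= c)%VS -> c = b].

Definition flag_variety (F : fieldType) (n : nat) (g : {vspace 'M[F]_n}) :
    set {vspace 'M[F]_n} :=
  [set b | borel_subalgebra g b].

Definition Ad (F : fieldType) (n : nat) (x : 'M[F]_n) (U : {vspace 'M[F]_n}) :
    {vspace 'M[F]_n} :=
  (linfun (mulmxr (invmx x) \o mulmx x) @: U)%VS.

Lemma AdP (F : fieldType) (n : nat) (x : 'M[F]_n) (U : {vspace 'M[F]_n}) Y :
  reflect (exists2 A, A \in U & Y = x *m A *m invmx x) (Y \in Ad x U).
Proof.
by apply: (iffP memv_imgP) => -[A AU ->]; exists A => //; rewrite lfunE.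
Qed.

Definition Ad_orbit (F : fieldType) (n : nat) (H : set 'M[F]_n)
    (b : {vspace 'M[F]_n}) : set {vspace 'M[F]_n} :=
  [set Ad h b | h in H].

Definition Ad_orbits (F : fieldType) (n : nat) (H : set 'M[F]_n)
    (X : set {vspace 'M[F]_n}) : set (set {vspace 'M[F]_n}) :=
  [set Ad_orbit H b | b in X].

(* Matrices act on column vectors.  The index k : 'I_(l.*2), counted from 0,
   stands for the basis vector e_(k+1) if k < l and for e_(k-2l) if k >= l, so
   that e_l and e_(-l) have the indices l - 1 and l, and j |-> -j is rev_ord. *)

Definition so_form (F : fieldType) (l : nat) : 'M[F]_(l.*2) :=
  \matrix_(j, k) (k == rev_ord j)%:R.

Definition SO_even (F : fieldType) (l : nat) : set 'M[F]_(l.*2) :=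
  [set g | g^T *m so_form F l *m g = so_form F l /\ \det g = 1].
Arguments SO_even F l : clear implicits.

(* A is in so(2l) if and only if A^T J + J A = 0, where J is [so_form F l]. *)
Definition so_defect (F : fieldType) (l : nat) (A : 'M[F]_(l.*2)) :
    'M[F]_(l.*2) :=
  A^T *m so_form F l + so_form F l *m A.

Fact so_defect_is_linear (F : fieldType) (l : nat) : linear (@so_defect F l).
Proof.
move=> a A B; rewrite /so_defect linearP /= mulmxDl mulmxDr.
by rewrite -scalemxAl -scalemxAr scalerDr addrACA.
Qed.

HB.instance Definition _ (F : fieldType) (l : nat) :=
  GRing.isLinear.Build F 'M[F]_(l.*2) 'M[F]_(l.*2) _
    (@so_defect F l) (@so_defect_is_linear F l).

Definition so_even (F : fieldType) (l : nat) : {vspace 'M[F]_(l.*2)} :=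
  lker (linfun (@so_defect F l)).

Lemma mem_so_even (F : fieldType) (l : nat) (A : 'M[F]_(l.*2)) :
  (A \in so_even F l) = (so_defect A == 0).
Proof. by rewrite memv_ker lfunE. Qed.

(* e_l - e_(-l), for l > 0. *)
Definition SO_odd_vector (F : fieldType) (l : nat) : 'cV[F]_(l.*2) :=
  \col_k ((k == l.-1 :> nat)%:R - (k == l :> nat)%:R).

Definition SO_odd (F : fieldType) (l : nat) : set 'M[F]_(l.*2) :=
  [set g | SO_even F l g /\ g *m SO_odd_vector F l = SO_odd_vector F l].
Arguments SO_odd F l : clear implicits.

(* [is_trig_mx] is lower triangularity. *)
Definition B_SO_odd (F : fieldType) (l : nat) : set 'M[F]_(l.*2) :=
  [set g | SO_odd F l g /\ is_trig_mx g^T].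
Arguments B_SO_odd F l : clear implicits.

Definition B_SO_odd_orbits (F : fieldType) (l : nat) :
    set (set {vspace 'M[F]_(l.*2)}) :=
  Ad_orbits (B_SO_odd F l) (flag_variety (so_even F l)).
Arguments B_SO_odd_orbits F l : clear implicits.

(* [fset_set A] is empty when A is infinite: this is the number of orbits only
   in conjunction with their finiteness. *)
Definition nb_B_SO_odd_orbits (F : fieldType) (l : nat) : nat :=
  if l is 0%N then 1%N else #|` fset_set (B_SO_odd_orbits F l)|%fset.

(* Main.v *)
(* A solvable subalgebra of so(2l) stabilizes a complete isotropic flag: by Lie's theorem
   it has an eigenvector, which can be chosen isotropic, and one descends to the middle
   block. Hence the Borel subalgebras are the conjugates Ad g b0 of the upper triangular
   one by g in O(2l), and by the Bruhat decomposition each of them is Ad (b w) b0 with b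
   in B, the upper triangular group, and w a signed permutation, unique up to exchanging
   e_l and e_(-l), which normalizes b0. As B_{SO(2l-1)} is the stabilizer in B of
   v = e_l - e_(-l), its orbits in B w b0 are the orbits of B n w B w^-1 on B v, and these
   have the representatives v + sum_(i in A) e_i with A an antichain (together with l and
   -l) for the order "i <= j and w^-1 i <= w^-1 j". Such an A amounts to a set on which
   w^-1 takes negative values in a prescribed order, so that the number of pairs (w, A) is
   sum_k 'C(l - 1, k) * 2^(l - 1 - k) * l! / (k + 1)!, with k = #|A|; on the other hand the
   coefficient of x^(m + 1) in (x / (1 - 2x))^(k + 1) is 'C(m, k) * 2^(m - k). *)

From HB Require Import structures.
Require Import Defs.
From mathcomp Require Import all_boot all_order all_algebra all_fingroup.
From mathcomp Require Import all_classical all_reals.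
From mathcomp Require Import mxred spectral ring zify.

Set Implicit Arguments.
Unset Strict Implicit.
Unset Printing Implicit Defensive.

Import GRing.Theory Num.Theory.

Local Open Scope ring_scope.

(** * Lie's theorem *)

(** The permutation [s] of the code is w^-1, since [perm_mx s] sends e_(s i) to e_i. Conjugation is
    by all of O(2l): g and its composite with the exchange of e_l and e_(-l) give the same
    subalgebra and have opposite determinants, so SO(2l) would only add a parity condition, while
    triangular orthogonal matrices have determinant 1 anyway. The order on indices comes from root
    elements: adding a multiple of coordinate j to coordinate i is allowed in both B and w B w^-1
    when i < j and s i < s j. A coordinate of b^-1 v is therefore cleared as soon as the support has
    an index above it for both orders, and an antichain remains. The pair l, -l stays in the support
    because the form keeps the product of these two coordinates at -1. As s l and s (-l) are
    opposite and an i in A must be sent beyond both, its sign changes. The elements of A and the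
    middle index, measured by their distance to the middle, are then k + 1 places on which s is
    increasing: l! / (k + 1)! permutations. Of the l signs, k are forced by A and one is spent on
    choosing between w and its composite with the exchange, whence 2^(l - 1 - k). *)

Section Krylov.
Variables (F : fieldType) (n : nat) (X : 'M[F]_n) (v : 'rV[F]_n).

Definition krylov_vec i : 'rV[F]_n := iter i (mulmxr X) v.
Definition krylov d : 'M[F]_(d, n) := \matrix_(i < d) krylov_vec i.

Lemma krylov_vec_sub i d : (i < d)%N -> (krylov_vec i <= krylov d)%MS.
Proof. by move=> id; have := row_sub (Ordinal id) (krylov d); rewrite rowK. Qed.

(** The factor [pid_mx i] shows the coordinates: in the basis [krylov d], an element of the span of
    [krylov i] has none from index i on. Triangularity is read off in this way. *)
Lemma krylov_pid i d : (i <= d)%N -> krylov i = pid_mx i *m krylov d.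
Proof.
move=> id; apply/row_matrixP => a; rewrite row_mul !rowK.
have ad : (a < d)%N := leq_trans (ltn_ord a) id.
rewrite mulmx_sum_row (bigD1 (Ordinal ad)) //= !mxE eqxx ltn_ord scale1r rowK.
rewrite big1 ?addr0 // => b; rewrite -(inj_eq val_inj) /= !mxE eq_sym => /negPf->.
by rewrite scale0r.
Qed.

Lemma krylov_mono i d : (i <= d)%N -> (krylov i <= krylov d)%MS.
Proof. by move=> /krylov_pid->; apply: submxMl. Qed.

Lemma krylov_mulX i : (krylov i *m X <= krylov i.+1)%MS.
Proof.
apply/row_subP => j; rewrite row_mul rowK -[_ *m X]/(krylov_vec j.+1).
by apply: krylov_vec_sub; rewrite ltnS ltn_ord.
Qed.

Lemma krylov_free d : (forall i, (i < d)%N -> ~~ (krylov_vec i <= krylov i)%MS) ->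
  row_free (krylov d).
Proof.
move=> nsub; rewrite -kermx_eq0; apply/negPn/negP => /rowV0Pn[u /sub_kermxP uK].
case/rV0Pn => i0 ui0.
case: (@arg_maxnP _ i0 (fun i => u 0 i != 0) (@nat_of_ord d) ui0) => i ui max_i.
case/negP: (nsub i (ltn_ord i)).
have : \sum_j u 0 j *: krylov_vec j = 0.
  by rewrite -[RHS]uK mulmx_sum_row; apply: eq_bigr => j _; rewrite rowK.
rewrite (bigD1 i) //= => /(canRL (addrK _)) /(canRL (scalerK ui)) ->.
rewrite sub0r scalemx_sub // eqmx_opp summx_sub // => j ji.
have [lt_ji|le_ij] := ltnP j i; first exact/scalemx_sub/krylov_vec_sub.
have [->|uj] := eqVneq (u 0 j) 0; first by rewrite scale0r sub0mx.
case/negP: ji; rewrite -(inj_eq val_inj) /= eqn_leq le_ij andbT; exact: max_i.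
Qed.

(** Take the least d for which v X^d depends on the earlier vectors; it exists because n + 1 rows of
    length n cannot be free. *)
Lemma krylov_stable : v != 0 ->
  exists d, [/\ (0 < d)%N, row_free (krylov d) & stablemx (krylov d) X].
Proof.
move=> v0.
have ex : exists d, (krylov_vec d <= krylov d)%MS.
  apply: contrapT => /forallNP nsub.
  have : row_free (krylov n.+1) by apply: krylov_free => i _; apply/negP.
  by move/eqP=> rk; have := rank_leq_col (krylov n.+1); rewrite rk ltnn.
case: (ex_minnP ex) => d sub_d min_d; exists d; split.
- case: d sub_d {min_d} => //; rewrite [krylov 0]flatmx0 => /submx0null/eqP.
  by rewrite /krylov_vec /= (negPf v0).
- by apply: krylov_free => i; apply: contraL => /min_d; rewrite -leqNgt.
apply/row_subP => j; rewrite row_mul rowK -[_ *m X]/(krylov_vec j.+1).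
have := ltn_ord j; rewrite leq_eqVlt => /predU1P[->//|jd].
exact: krylov_vec_sub.
Qed.

End Krylov.

(* The trace of [X, A] vanishes on the Krylov space of v under X, where A acts
   by triangular matrices with the constant diagonal lam A. *)
Lemma lie_weight_bracket (F : numFieldType) n (K : {vspace 'M[F]_n}) (X : 'M[F]_n)
    (v : 'rV[F]_n) (lam : 'M[F]_n -> F) :
    v != 0 -> (forall A, A \in K -> v *m A = lam A *: v) ->
    (forall A, A \in K -> lie_bracket X A \in K) ->
  forall A, A \in K -> lam (lie_bracket X A) = 0.
Proof.
move=> v0 vK XK.
have [d [d_gt0 freeV stX]] := krylov_stable X v0.
set V := krylov X v d in freeV stX.
have tri i A : A \in K ->
    (krylov_vec X v i *m A - lam A *: krylov_vec X v i <= krylov X v i)%MS.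
  elim: i A => [|i IHi] A AK; first by rewrite /krylov_vec /= vK // subrr sub0mx.
  (* From X A = A X + [X, A]. The induction hypothesis serves for A and for [X, A], hence the
     quantification over A in it. *)
  have -> : krylov_vec X v i.+1 *m A - lam A *: krylov_vec X v i.+1 =
      (krylov_vec X v i *m A - lam A *: krylov_vec X v i) *m X
      + krylov_vec X v i *m lie_bracket X A.
    rewrite /krylov_vec /= /lie_bracket mulmxBl mulmxBr !mulmxA -scalemxAl.
    by rewrite [RHS]addrC addrA subrK.
  apply: addmx_sub.
    by apply: submx_trans (krylov_mulX X v i); apply/submxMr/IHi.
  rewrite -[_ *m lie_bracket X A](subrK (lam (lie_bracket X A) *: krylov_vec X v i)).
  apply: addmx_sub; last exact/scalemx_sub/krylov_vec_sub.
  by apply: submx_trans (IHi _ (XK _ AK)) (krylov_mono _ _ _).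
have stK A : A \in K -> stablemx V A.
  move=> AK; apply/row_subP => i; rewrite row_mul rowK.
  rewrite -[_ *m A](subrK (lam A *: krylov_vec X v i)).
  apply: addmx_sub; last exact/scalemx_sub/krylov_vec_sub.
  by apply: submx_trans (tri i A AK) (krylov_mono _ _ _); apply: ltnW.
have diag A i : A \in K -> conjmx V A i i = lam A.
  move=> AK; have /submxP[y yE] := tri i A AK.
  have rowE : row i (conjmx V A) = lam A *: delta_mx 0 i + y *m pid_mx i.
    apply: (row_free_inj freeV); rewrite -row_mul mulmxKpV ?stK // mulmxDl.
    rewrite -mulmxA -krylov_pid 1?ltnW // -yE row_mul -scalemxAl -rowE rowK.
    by rewrite addrC subrK.
  have := congr1 (fun r : 'rV_d => r 0 i) rowE.
  rewrite mxE => ->; rewrite !mxE !eqxx mulr1 big1 ?addr0 // => a _.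
  by rewrite !mxE (ltn_eqF (ltn_ord a)) mulr0.
move=> A AK.
have : \tr (conjmx V (lie_bracket X A)) = 0.
  have -> : conjmx V (lie_bracket X A) =
      conjmx V X *m conjmx V A - conjmx V A *m conjmx V X.
    rewrite -(conjmxM stX (stK _ AK)) -(conjmxM (stK _ AK) stX).
    by rewrite /lie_bracket /conjmx mulmxBr mulmxBl.
  by rewrite linearB /= mxtrace_mulC subrr.
rewrite /mxtrace (eq_bigr (fun=> lam (lie_bracket X A))); last first.
  by move=> i _; rewrite diag ?XK.
(* The trace is d times the weight, and d > 0 is invertible in characteristic zero. *)
rewrite sumr_const card_ord => /eqP; rewrite mulrn_eq0 => /orP[|/eqP //].
by rewrite eqn0Ngt d_gt0.
Qed.

(** * Derived algebras and solvability *)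

Section DerivedAlgebra.
Variables (F : fieldType) (n : nat).
Implicit Types U V : {vspace 'M[F]_n}.

Lemma derived_algS U V : (U <= V)%VS -> (derived_alg U <= derived_alg V)%VS.
Proof.
move=> /subvP UV; apply/derived_algP => A B AU BU.
by apply: (derived_algP _ _).1 => //; apply: UV.
Qed.

Lemma mem_derived_alg U A B : A \in U -> B \in U -> lie_bracket A B \in derived_alg U.
Proof. exact: (derived_algP _ _).1. Qed.

Lemma iter_derived_algS k U V : (U <= V)%VS ->
  (iter k (@derived_alg F n) U <= iter k (@derived_alg F n) V)%VS.
Proof. by move=> UV; elim: k => //= k; apply: derived_algS. Qed.

Lemma lie_solvableS U V : (U <= V)%VS -> lie_solvable V -> lie_solvable U.
Proof.
move=> UV [k Vk]; exists k; apply/eqP; rewrite -subv0 -Vk.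
exact: iter_derived_algS.
Qed.

Lemma lie_subalgebra_derived U : lie_subalgebra U -> (derived_alg U <= U)%VS.
Proof. by move=> Usub; apply/derived_algP. Qed.

Lemma derived_alg_proper U : lie_solvable U -> U != 0%VS -> derived_alg U <> U.
Proof.
move=> [k Uk] U0 dU; case/eqP: U0; rewrite -Uk.
by elim: k {Uk} => //= k <-.
Qed.

End DerivedAlgebra.

(* Lie's theorem: K is an ideal of L of codimension at most one, and the weight
   space of K is stable under L by [lie_weight_bracket]. *)
Theorem lie_common_eigenvector (C : numClosedFieldType) n (L : {vspace 'M[C]_n}) :
    (0 < n)%N -> lie_subalgebra L -> lie_solvable L ->
  exists2 v : 'rV[C]_n, v != 0 & forall A, A \in L -> exists a, v *m A = a *: v.
Proof.
move=> n_gt0; have [d] := ubnP (\dim L); elim: d L => // d IHd L dimL subL solL.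
have [L0|L0] := eqVneq L 0%VS.
  exists (const_mx 1) => [|A]; last first.
    by rewrite L0 memv0 => /eqP->; exists 0; rewrite mulmx0 scale0r.
  by apply/rV0Pn; exists (Ordinal n_gt0); rewrite mxE oner_eq0.
have DL := lie_subalgebra_derived subL.
have : (L :\: derived_alg L)%VS != 0%VS.
  apply/eqP => LD; apply: (derived_alg_proper solL L0).
  apply/eqP; rewrite eqEsubv DL /= -diffv_eq0; exact/eqP.
rewrite -vpick0; set X := vpick _ => X0.
pose D := derived_alg L.
(* K is D plus a complement of the line of X in Q, where L = Q + D. Containing D makes K both a
   subalgebra and an ideal of L. *)
have [K [DK KL dimK LE]] : exists K, [/\ (D <= K)%VS, (K <= L)%VS,
    (\dim K < \dim L)%N & forall A, A \in L -> exists c, A - c *: X \in K].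
  pose Q := (L :\: D)%VS; pose P := (Q :\: <[X]>)%VS.
  have XQ : X \in Q := memv_pick _.
  have QXE : (Q :&: <[X]>)%VS = <[X]>%VS by apply/capv_idPr; rewrite -memvE.
  exists (D + P)%VS; split; first exact: addvSl.
  - by rewrite subv_add DL; apply: subv_trans (diffvSl _ _) (diffvSl _ _).
  - apply: leq_ltn_trans (dimv_add_leqif D P) _.
    have := dimv_cap_compl L D; have := dimv_cap_compl Q <[X]>%VS.
    rewrite -/P -/Q QXE dim_vline X0 (capv_idPr DL) => <- <-.
    by rewrite ltn_add2l add1n.
  move=> A; rewrite -(addv_diff_cap L D) (capv_idPr DL) -/Q.
  move=> /memv_addP[q qQ [e eD ->]].
  move: qQ; rewrite -{1}(addv_diff_cap Q <[X]>%VS) QXE -/P.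
  move=> /memv_addP[p pP [_ /vlineP[c ->] ->]]; exists c.
  by rewrite addrAC addrK addrC memv_add.
have subK : lie_subalgebra K.
  move=> A B AK BK; apply: (subvP DK).
  by apply: mem_derived_alg; apply: (subvP KL).
have [v v0 vK] := IHd K (leq_trans dimK dimL) subK (lie_solvableS KL solL).
have XL : X \in L by apply: (subvP (diffvSl L D)); apply: memv_pick.
case/rV0Pn: (v0) => i vi.
(* A total function read off a nonzero coordinate of v; it is a weight on K only. *)
pose lam (A : 'M_n) := (v *m A) 0 i / v 0 i.
have vE A : A \in K -> v *m A = lam A *: v.
  by move=> /vK[a va]; rewrite /lam va mxE mulfK.
have XK A : A \in K -> lie_bracket X A \in K.
  move=> AK; apply: (subvP DK); apply: mem_derived_alg => //; exact: (subvP KL).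
have lam0 := lie_weight_bracket v0 vE XK.
pose Wi (j : 'I_(\dim K)) := kermx ((vbasis K)`_j - (lam (vbasis K)`_j)%:M).
pose W := (\bigcap_j Wi j)%MS.
have WP (w : 'rV_n) : reflect (forall A, A \in K -> w *m A = lam A *: w) (w <= W)%MS.
  apply: (iffP sub_bigcapmxP) => [wK A AK|wK j _]; last first.
    apply/sub_kermxP; rewrite mulmxBr wK ?mul_mx_scalar ?subrr //.
    by apply: vbasis_mem; rewrite mem_nth ?size_tuple.
  have lamE : lam A = \sum_j coord (vbasis K) j A * lam (vbasis K)`_j.
    rewrite {1}/lam {1}(coord_vbasis AK) mulmx_sumr summxE mulr_suml.
    by apply: eq_bigr => j _; rewrite -scalemxAr mxE mulrA.
  rewrite lamE {1}(coord_vbasis AK) mulmx_sumr scaler_suml; apply: eq_bigr => j _.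
  have /sub_kermxP/eqP := wK j isT; rewrite mulmxBr mul_mx_scalar subr_eq0 => /eqP wj.
  by rewrite -scalemxAr wj scalerA.
have W0 : W != 0.
  by apply/rowV0Pn; exists v => //; apply/WP.
have stW : stablemx W X.
  apply/rV_subP => _ /submxP[w ->]; rewrite mulmxA.
  have /WP wW : (w *m W <= W)%MS by apply: submxMl.
  apply/WP => A AK; have := wW _ (XK _ AK).
  rewrite lam0 // scale0r /lie_bracket mulmxBr => /eqP; rewrite subr_eq0 => /eqP.
  by rewrite !mulmxA => ->; rewrite (wW A AK) -scalemxAl.
have [|a] := @eigenvalue_closed C _ (restrictmx W X).
  by move=> *; rewrite lt0n mxrank_eq0.
case/eigenvalueP => u uX u0; pose w1 := u *m row_base W.
have wW : (w1 <= W)%MS by rewrite (submx_trans (submxMl _ _)) ?eq_row_base.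
exists w1 => [|A AL]; first by rewrite mulmx_free_eq0 ?row_base_free.
have wX : w1 *m X = a *: w1.
  have stE : restrictmx W X *m row_base W = row_base W *m X.
    by rewrite /conjmx mulmxKpV ?stablemx_row_base.
  by rewrite /w1 -mulmxA -stE mulmxA uX -scalemxAl.
have [c AcX] := LE A AL; exists (lam (A - c *: X) + c * a).
by rewrite scalerDl -(scalerA c a) -wX (scalemxAr c w1) -(WP w1 wW _ AcX) -mulmxDr subrK.
Qed.

(** * The orthogonal group and the upper triangular Borel subalgebra *)

Lemma rev_ord_neq l (i : 'I_(l.*2)) : rev_ord i != i.
Proof.
rewrite -(inj_eq val_inj) /=; apply/eqP => e.
have := ltn_ord i; lia.
Qed.

Lemma ltn_rev_ord n (i j : 'I_n) : (rev_ord i < rev_ord j)%N = (j < i)%N.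
Proof. by rewrite /= ltn_sub2lE // ltnS. Qed.

Lemma leq_rev_ord n (i j : 'I_n) : (rev_ord i <= rev_ord j)%N = (j <= i)%N.
Proof. by rewrite leqNgt ltn_rev_ord -leqNgt. Qed.

Section AdTheory.
Variables (F : fieldType) (n : nat).
Implicit Types (x y A : 'M[F]_n) (U V : {vspace 'M[F]_n}).

Lemma invmx_mul x y : x \in unitmx -> y \in unitmx ->
  invmx (x *m y) = invmx y *m invmx x.
Proof.
move=> ux uy; have uxy : x *m y \in unitmx by rewrite unitmx_mul ux.
by rewrite -[RHS](mulmxK uxy) -(mulmxA (invmx y)) (mulKmx ux) mulVmx // mul1mx.
Qed.

Lemma mem_Ad x U A : x \in unitmx -> (A \in Ad x U) = (invmx x *m A *m x \in U).
Proof.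
move=> ux; apply/AdP/idP => [[B BU ->]|AU]; last first.
  by exists (invmx x *m A *m x) => //; rewrite !mulmxA mulmxV // mul1mx mulmxK.
by rewrite !mulmxA mulVmx // mul1mx mulmxKV.
Qed.

Lemma Ad_mul x y U : x \in unitmx -> y \in unitmx -> Ad (x *m y) U = Ad x (Ad y U).
Proof.
move=> ux uy; apply/vspaceP => A.
by rewrite !mem_Ad ?unitmx_mul ?ux // invmx_mul // !mulmxA.
Qed.

Lemma Ad1 U : Ad 1%:M U = U.
Proof. by apply/vspaceP => A; rewrite mem_Ad ?unitmx1 // invmx1 mul1mx mulmx1. Qed.

Lemma AdK x U : x \in unitmx -> Ad (invmx x) (Ad x U) = U.
Proof. by move=> ux; rewrite -Ad_mul ?unitmx_inv // mulVmx // Ad1. Qed.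

Lemma AdKV x U : x \in unitmx -> Ad x (Ad (invmx x) U) = U.
Proof. by move=> ux; rewrite -Ad_mul ?unitmx_inv // mulmxV // Ad1. Qed.

Lemma AdS x U V : x \in unitmx -> (U <= V)%VS -> (Ad x U <= Ad x V)%VS.
Proof.
by move=> ux /subvP UV; apply/subvP => A; rewrite !mem_Ad // => /UV.
Qed.

Lemma dim_Ad x U : x \in unitmx -> \dim (Ad x U) = \dim U.
Proof.
have le z W : (\dim (Ad z W) <= \dim W)%N.
  by rewrite -(limg_ker_dim (linfun (mulmxr (invmx z) \o mulmx z)) W) leq_addl.
move=> ux; apply/eqP; rewrite eqn_leq le /=; by rewrite -{1}(AdK U ux) le.
Qed.

Lemma lie_bracket_conj x A B : x \in unitmx ->
  lie_bracket (invmx x *m A *m x) (invmx x *m B *m x) = invmx x *m lie_bracket A B *m x.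
Proof.
by move=> ux; rewrite /lie_bracket mulmxBr mulmxBl !mulmxA !mulmxK.
Qed.

Lemma Ad_subalgebra x U : x \in unitmx -> lie_subalgebra U -> lie_subalgebra (Ad x U).
Proof.
move=> ux subU A B; rewrite !mem_Ad // => AU BU.
by rewrite -lie_bracket_conj //; apply: subU.
Qed.

Lemma derived_alg_Ad x U : x \in unitmx ->
  (derived_alg (Ad x U) <= Ad x (derived_alg U))%VS.
Proof.
move=> ux; apply/derived_algP => A B; rewrite !mem_Ad // => AU BU.
by rewrite -lie_bracket_conj //; apply: mem_derived_alg.
Qed.

Lemma Ad_solvable x U : x \in unitmx -> lie_solvable U -> lie_solvable (Ad x U).
Proof.
move=> ux [k Uk]; exists k; apply/eqP; rewrite -subv0.
suff le : (iter k (@derived_alg F n) (Ad x U) <= Ad x (iter k (@derived_alg F n) U))%VS.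
  apply: subv_trans le _; rewrite Uk; apply/subvP => A; rewrite mem_Ad // !memv0.
  move=> /eqP/(congr1 (fun M => x *m M *m invmx x)).
  by rewrite !mulmxA mulmxV // mul1mx mulmxK // mulmx0 mul0mx => /eqP.
elim: k {Uk} => //= k IHk; apply: subv_trans (derived_algS IHk) _.
exact: derived_alg_Ad.
Qed.

End AdTheory.

(** * The filtration of the matrix algebra by superdiagonals *)

Section UpperTriangular.
Variables (F : fieldType) (n : nat).
Implicit Types A B : 'M[F]_n.

Lemma uptriP A : reflect (forall i j : 'I_n, (j < i)%N -> A i j = 0) (is_trig_mx A^T).
Proof.
by apply: (iffP is_trig_mxP) => AT i j ij; have := AT j i ij; rewrite mxE.
Qed.

Lemma uptri1 : is_trig_mx (1%:M : 'M[F]_n)^T.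
Proof. by rewrite trmx1 scalar_mx_is_trig. Qed.

(** A linear map, so that its kernel is a [vspace]: the matrices supported on j >= i + k, upper
    triangular for k = 0 and strictly so for k = 1. *)
Definition below_part k A : 'M[F]_n := \matrix_(i, j) if (j < i + k)%N then A i j else 0.

Fact below_part_is_linear k : linear (below_part k).
Proof.
move=> a A B; apply/matrixP => i j; rewrite !mxE; case: ifP => _ //.
by rewrite mulr0 addr0.
Qed.
HB.instance Definition _ k :=
  GRing.isLinear.Build F 'M[F]_n 'M[F]_n _ (below_part k) (below_part_is_linear k).

Definition upper_alg k : {vspace 'M[F]_n} := lker (linfun (below_part k)).

Lemma mem_upper_alg k A :
  reflect (forall i j : 'I_n, (j < i + k)%N -> A i j = 0) (A \in upper_alg k).
Proof.
rewrite memv_ker lfunE /=; apply: (iffP eqP) => [A0 i j ij|A0].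
  by have /matrixP/(_ i j) := A0; rewrite !mxE ij.
by apply/matrixP => i j; rewrite !mxE; case: ifP => // /A0.
Qed.

Lemma upper_algM k m A B : A \in upper_alg k -> B \in upper_alg m ->
  A *m B \in upper_alg (k + m).
Proof.
move=> /mem_upper_alg Ak /mem_upper_alg Bm; apply/mem_upper_alg => i j ij.
rewrite mxE big1 // => p _; have [pi|ip] := ltnP p (i + k); first by rewrite Ak ?mul0r.
by rewrite Bm ?mulr0 //; apply: leq_trans ij _; rewrite addnA leq_add2r.
Qed.

Lemma upper_alg_le k m : (k <= m)%N -> (upper_alg m <= upper_alg k)%VS.
Proof.
move=> km; apply/subvP => A /mem_upper_alg Am; apply/mem_upper_alg => i j ij.
by apply: Am; apply: leq_trans ij _; rewrite leq_add2l.
Qed.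

(** The diagonal of a product of triangular matrices is the product of the diagonals, so the
    diagonals of A B and B A cancel. *)
Lemma lie_bracket_upper A B : A \in upper_alg 0 -> B \in upper_alg 0 ->
  lie_bracket A B \in upper_alg 1.
Proof.
move=> A0 B0; have := upper_algM A0 B0; have := upper_algM B0 A0.
move=> /mem_upper_alg BA /mem_upper_alg AB.
move/mem_upper_alg: A0 => A0; move/mem_upper_alg: B0 => B0.
apply/mem_upper_alg => i j; rewrite addn1 ltnS leq_eqVlt !mxE => /orP[/eqP/val_inj ->|ij].
  have diag (P Q : 'M[F]_n) : (forall i j : 'I_n, (j < i + 0)%N -> P i j = 0) ->
      (forall i j : 'I_n, (j < i + 0)%N -> Q i j = 0) ->
      \sum_k P i k * Q k i = P i i * Q i i.
    move=> P0 Q0; rewrite (bigD1 i) //= big1 ?addr0 // => k.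
    rewrite -(inj_eq val_inj) /= neq_ltn => /orP[ki|ik].
      by rewrite P0 ?mul0r ?addn0.
    by rewrite Q0 ?mulr0 ?addn0.
  by rewrite !diag // mulrC subrr.
have := AB i j; have := BA i j; rewrite !mxE !addn0 => -> // -> //.
by rewrite subrr.
Qed.

Lemma upper_alg_solvable : lie_solvable (upper_alg 0).
Proof.
have le k : (iter k.+1 (@derived_alg F n) (upper_alg 0) <= upper_alg k.+1)%VS.
  elim: k => [|k IHk]; first by apply/derived_algP => A B; apply: lie_bracket_upper.
  apply/derived_algP => A B /(subvP IHk) Ak /(subvP IHk) Bk.
  apply: (subvP (upper_alg_le (_ : k.+2 <= k.+1 + k.+1)%N)); first by rewrite addSn !ltnS leq_addl.
  by rewrite memvB ?upper_algM.
exists n.+1; apply/eqP; rewrite -subv0; apply: subv_trans (le n) _.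
apply/subvP => A /mem_upper_alg A0; rewrite memv0; apply/eqP/matrixP => i j.
rewrite mxE A0 //; apply: leq_trans (ltn_ord j) _.
by rewrite addnS leqW // leq_addl.
Qed.

Lemma uptri_upper_alg A : (A \in upper_alg 0) = is_trig_mx A^T.
Proof.
by apply/mem_upper_alg/uptriP => A0 i j; have := A0 i j; rewrite addn0.
Qed.

Lemma uptriM A B : is_trig_mx A^T -> is_trig_mx B^T -> is_trig_mx (A *m B)^T.
Proof. by rewrite -!uptri_upper_alg; apply: (@upper_algM 0 0). Qed.

End UpperTriangular.

(** * The orthogonal group, its Lie algebra and its root elements *)

Section Orthogonal.
Variables (F : fieldType) (l : nat).
Local Notation N := l.*2.
Local Notation J := (so_form F l).
Implicit Types g h A : 'M[F]_N.

Lemma so_formM m (A : 'M[F]_(N, m)) i j : (J *m A) i j = A (rev_ord i) j.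
Proof.
rewrite mxE (bigD1 (rev_ord i)) //= mxE eqxx mul1r big1 ?addr0 // => k.
by rewrite mxE => /negPf->; rewrite mul0r.
Qed.

Lemma mulm_so_form m (A : 'M[F]_(m, N)) i j : (A *m J) i j = A i (rev_ord j).
Proof.
rewrite mxE (bigD1 (rev_ord j)) //= mxE rev_ordK eqxx mulr1 big1 ?addr0 // => k.
rewrite mxE => kj; rewrite (_ : (j == rev_ord k) = false) ?mulr0 //.
by apply: contra_neqF kj => /eqP->; rewrite rev_ordK.
Qed.

Lemma so_formK : J *m J = 1%:M.
Proof.
by apply/matrixP => i j; rewrite so_formM !mxE rev_ordK eq_sym.
Qed.

Lemma tr_so_form : J^T = J.
Proof.
apply/matrixP => i j; rewrite !mxE; congr (_ %:R); congr nat_of_bool.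
by apply/eqP/eqP => ->; rewrite rev_ordK.
Qed.

Definition orth g : Prop := g^T *m J *m g = J.

Lemma orth_invE g : orth g -> (J *m g^T *m J) *m g = 1%:M.
Proof. by move=> og; rewrite -!mulmxA [g^T *m _]mulmxA og so_formK. Qed.

Lemma orth_unit g : orth g -> g \in unitmx.
Proof. by move/orth_invE/mulmx1_unit => []. Qed.

Lemma orth_inv g : orth g -> invmx g = J *m g^T *m J.
Proof.
move=> og; have ug := orth_unit og.
by rewrite -[RHS](mulmxK ug) orth_invE // mul1mx.
Qed.

(** The inverse is the reflection of g in the antidiagonal, so columns of the inverse are rows of
    g. *)
Lemma orth_invmxE g i j : orth g -> invmx g i j = g (rev_ord j) (rev_ord i).
Proof. by move=> og; rewrite orth_inv // mulm_so_form so_formM mxE. Qed.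

Lemma orth1 : orth 1%:M.
Proof. by rewrite /orth trmx1 mul1mx mulmx1. Qed.

Lemma orthM g h : orth g -> orth h -> orth (g *m h).
Proof.
rewrite /orth => og oh; rewrite trmx_mul -!mulmxA (mulmxA J) (mulmxA g^T) (mulmxA g^T).
by rewrite og mulmxA.
Qed.

Lemma orthV g : orth g -> orth (invmx g).
Proof.
move=> og; have ug := orth_unit og; rewrite /orth -{1}og.
by rewrite -!mulmxA mulmxV // mulmx1 mulmxA trmx_inv mulVmx ?unitmx_tr // mul1mx.
Qed.

Lemma orth_col g i j : orth g ->
  \sum_k g (rev_ord k) i * g k j = (j == rev_ord i)%:R.
Proof.
move=> og; have /matrixP/(_ i j) := og; rewrite [in RHS]mxE => <-.
by rewrite mxE; apply: eq_bigr => k _; rewrite mulm_so_form mxE.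
Qed.

Lemma so_evenE A : (A \in so_even F l) = (A^T == - (J *m A *m J)).
Proof.
rewrite mem_so_even /so_defect; apply/eqP/eqP => [/(congr1 (mulmxr J))|] /=.
  rewrite mulmxDl -!mulmxA so_formK mulmx1 mul0mx => /eqP.
  by rewrite addr_eq0 => /eqP.
by move=> ->; rewrite mulNmx -!mulmxA so_formK mulmx1 addNr.
Qed.

Lemma so_evenP A :
  reflect (forall i j, A (rev_ord i) (rev_ord j) = - A j i) (A \in so_even F l).
Proof.
rewrite so_evenE; apply: (iffP eqP) => [AE i j|AE].
  have /matrixP/(_ i j) := AE; rewrite [LHS]mxE => ->.
  by rewrite mxE mulm_so_form so_formM opprK.
by apply/matrixP => i j; rewrite mxE [RHS]mxE mulm_so_form so_formM AE opprK.
Qed.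

Lemma Ad_so_even g : orth g -> Ad g (so_even F l) = so_even F l.
Proof.
have le h : orth h -> (Ad h (so_even F l) <= so_even F l)%VS.
  move=> oh; apply/subvP => _ /AdP[A AE ->]; move: AE; rewrite !so_evenE => /eqP AE.
  rewrite orth_inv // !trmx_mul tr_so_form trmxK AE !mulNmx !mulmxN !mulmxA.
  rewrite -[_ *m J *m J]mulmxA so_formK mulmx1.
  by rewrite -[_ *m J *m J]mulmxA so_formK mulmx1.
move=> og; apply/eqP; rewrite eqEsubv le //=.
rewrite -{1}(AdKV (so_even F l) (orth_unit og)); apply: AdS (orth_unit og) _.
by apply/le/orthV.
Qed.

Lemma uptri_orthV g : orth g -> is_trig_mx g^T -> is_trig_mx (invmx g)^T.
Proof.
move=> og /uptriP gt; apply/uptriP => i j ij; rewrite orth_invmxE // gt //.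
by rewrite ltn_rev_ord.
Qed.

Lemma orth_uptri_diag g i : orth g -> is_trig_mx g^T -> g i i * g (rev_ord i) (rev_ord i) = 1.
Proof.
move=> og /uptriP gt; have := orth_col i (rev_ord i) og; rewrite eqxx.
rewrite (bigD1 (rev_ord i)) //= rev_ordK big1 ?addr0 // => k.
rewrite -(inj_eq val_inj) neq_ltn => /orP[ki|ik].
  by rewrite gt ?mul0r // -ltn_rev_ord rev_ordK.
by rewrite mulrC gt ?mul0r.
Qed.

(** The diagonal entries cancel in opposite pairs. The determinant condition of [SO_even] is thus
    automatic on triangular matrices. *)
Lemma orth_uptri_det g : orth g -> is_trig_mx g^T -> \det g = 1.
Proof.
move=> og gt; rewrite -det_tr det_trig // (bigID (fun i : 'I_N => i < l)%N) /=.
rewrite [X in _ * X](reindex_inj rev_ord_inj) /=.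
have PE (i : 'I_N) : ~~ (N - i.+1 < l)%N = (i < l)%N.
  by have := ltn_ord i; lia.
under [X in _ * X]eq_bigl do rewrite PE.
rewrite -big_split /= big1 // => i _.
by rewrite !mxE orth_uptri_diag.
Qed.

Definition so_borel : {vspace 'M[F]_N} := (so_even F l :&: upper_alg F N 0)%VS.

Lemma mem_so_borel A : (A \in so_borel) = (A \in so_even F l) && is_trig_mx A^T.
Proof. by rewrite memv_cap uptri_upper_alg. Qed.

Lemma so_even_subalgebra : lie_subalgebra (so_even F l).
Proof.
move=> A B; rewrite !so_evenE => /eqP AE /eqP BE; rewrite /lie_bracket.
rewrite linearB /= !trmx_mul AE BE !mulNmx !mulmxN !opprK.
have JJ (X Y : 'M[F]_N) : J *m X *m J *m (J *m Y *m J) = J *m (X *m Y) *m J.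
  by rewrite !mulmxA -[_ *m J *m J]mulmxA so_formK mulmx1.
by rewrite !JJ mulmxBr mulmxBl opprB.
Qed.

Lemma so_borel_subalgebra : lie_subalgebra so_borel.
Proof.
move=> A B; rewrite !memv_cap => /andP[As A0] /andP[Bs B0].
rewrite so_even_subalgebra //=; apply: (subvP (upper_alg_le _ _ (leq0n 1))).
exact: lie_bracket_upper.
Qed.

Lemma so_borel_solvable : lie_solvable so_borel.
Proof. exact: lie_solvableS (capvSr _ _) (upper_alg_solvable F N). Qed.

Lemma Ad_so_borel g : orth g -> is_trig_mx g^T -> Ad g so_borel = so_borel.
Proof.
have le h : orth h -> is_trig_mx h^T -> (Ad h so_borel <= so_borel)%VS.
  move=> oh ht; apply/subvP => A; rewrite mem_Ad ?orth_unit // !mem_so_borel.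
  rewrite -mem_Ad ?orth_unit // Ad_so_even // => /andP[-> At] /=.
  have := uptriM (uptriM ht At) (uptri_orthV oh ht).
  by rewrite !mulmxA mulmxV ?orth_unit // mul1mx mulmxK ?orth_unit.
move=> og gt; apply/eqP; rewrite eqEsubv le //=.
rewrite -{1}(AdKV so_borel (orth_unit og)); apply: AdS (orth_unit og) _.
by apply: le; [apply: orthV|apply: uptri_orthV].
Qed.

(** A root vector of so(2l): the second unit matrix is forced by antisymmetry about the
    antidiagonal. It is zero for j = [rev_ord i], which is the source of the special cases below. *)
Definition root_mx (i j : 'I_N) : 'M[F]_N :=
  delta_mx i j - delta_mx (rev_ord j) (rev_ord i).

Lemma root_mxE i j a b :
  root_mx i j a b = ((a == i) && (b == j))%:R - ((a == rev_ord j) && (b == rev_ord i))%:R.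
Proof. by rewrite !mxE. Qed.

Lemma root_mx_so i j : root_mx i j \in so_even F l.
Proof.
apply/so_evenP => a b; rewrite !root_mxE opprB.
by rewrite !(inj_eq rev_ord_inj) ![rev_ord _ == _](can2_eq rev_ordK rev_ordK)
  [(b == rev_ord j) && _]andbC [(b == i) && _]andbC.
Qed.

Lemma root_mx_sq i j : i != j -> root_mx i j *m root_mx i j = 0.
Proof.
move=> ij; rewrite /root_mx mulmxBl !mulmxBr !mul_delta_mx_cond.
rewrite (inj_eq rev_ord_inj) [j == i]eq_sym (negPf ij).
rewrite ![_ == rev_ord _]eq_sym !(negPf (rev_ord_neq _)).
by rewrite !mulr0n !subr0.
Qed.

(** The exponential of c times a root vector: for i != j its square is zero and the series stops
    here. *)
Definition root_elt (i j : 'I_N) (c : F) : 'M[F]_N := 1%:M + c *: root_mx i j.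

Lemma root_elt_orth i j c : i != j -> orth (root_elt i j c).
Proof.
move=> ij; rewrite /orth /root_elt [(1%:M + _)^T]linearD /= trmx1.
have : c *: root_mx i j \in so_even F l by rewrite memvZ // root_mx_so.
have : (c *: root_mx i j) *m (c *: root_mx i j) = 0.
  by rewrite -scalemxAl -scalemxAr root_mx_sq // !scaler0.
move: (c *: _) => M MM; rewrite so_evenE => /eqP->.
rewrite mulmxDl mul1mx mulNmx -[_ *m J *m J]mulmxA so_formK mulmx1.
by rewrite mulmxDr mulmx1 mulmxBl -(mulmxA J) MM mulmx0 subr0 subrK.
Qed.

Lemma root_elt_uptri (i j : 'I_N) c : (i < j)%N -> is_trig_mx (root_elt i j c)^T.
Proof.
move=> ij; apply/is_trig_mxP => a b ab.
rewrite !mxE [b == a]eq_sym -(inj_eq val_inj) /= (ltn_eqF ab) add0r.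
have -> : (b == i) && (a == j) = false.
  apply/negP => /andP[/eqP bi /eqP aj]; move: ab ij; rewrite bi aj => ab ij.
  by have := ltn_trans ab ij; rewrite ltnn.
have -> : (b == rev_ord j) && (a == rev_ord i) = false.
  apply/negP => /andP[/eqP bi /eqP aj]; move: ab; rewrite bi aj ltn_rev_ord => ab.
  by have := ltn_trans ab ij; rewrite ltnn.
by rewrite subrr mulr0.
Qed.

Lemma root_eltE m (A : 'M[F]_(N, m)) i j c a b :
  (root_elt i j c *m A) a b =
  A a b + c * ((a == i)%:R * A j b - (a == rev_ord j)%:R * A (rev_ord i) b).
Proof.
rewrite /root_elt mulmxDl mul1mx mxE; congr (_ + _).
rewrite -scalemxAl mxE; congr (_ * _); rewrite mulmxBl !mxE.
have dE p q : \sum_k (delta_mx p q : 'M[F]_N) a k * A k b = (a == p)%:R * A q b.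
  rewrite (bigD1 q) //= mxE eqxx andbT big1 ?addr0 // => k /negPf kq.
  by rewrite mxE kq andbF mul0r.
by rewrite !dE.
Qed.

Lemma perm_mx_orth (s : {perm 'I_N}) :
  (forall i, s (rev_ord i) = rev_ord (s i)) -> orth (perm_mx s).
Proof.
move=> sr; apply/matrixP => i j; rewrite -mulmxA tr_perm_mx -row_permE mxE so_formM.
by rewrite !mxE sr permKV eq_sym.
Qed.

Lemma perm_mx_delta (s : {perm 'I_N}) i : perm_mx s *m delta_mx (s i) 0 = delta_mx i 0 :> 'cV[F]_N.
Proof.
apply/colP => a; rewrite -row_permE !mxE !andbT.
by rewrite (inj_eq perm_inj).
Qed.

Lemma sum_delta (y : 'cV[F]_N) : y = \sum_a y a 0 *: delta_mx a 0.
Proof.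
apply/colP => i; rewrite summxE (bigD1 i) //= !mxE eqxx mulr1 big1 ?addr0 // => a.
by rewrite !mxE eq_sym => /negPf->; rewrite mulr0.
Qed.

End Orthogonal.

(** * Isotropic eigenvectors *)

Section LieImage.
Variables (F : fieldType) (n m : nat) (phi : {linear 'M[F]_n -> 'M[F]_m}).
Variable L : {vspace 'M[F]_n}.
Hypotheses (subL : lie_subalgebra L)
  (phiL : forall A B, A \in L -> B \in L ->
     phi (lie_bracket A B) = lie_bracket (phi A) (phi B)).

(** Brackets are preserved on L only: restriction to a subspace, or to a diagonal block, is
    multiplicative only on matrices that respect it. *)
Lemma lie_image_subalgebra : lie_subalgebra (linfun phi @: L)%VS.
Proof.
move=> _ _ /memv_imgP[A AL ->] /memv_imgP[B BL ->].
by rewrite !lfunE /= -phiL // -[phi _]lfunE memv_img ?subL.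
Qed.

Lemma lie_image_solvable : lie_solvable L -> lie_solvable (linfun phi @: L)%VS.
Proof.
move=> [k Lk]; exists k; apply/eqP; rewrite -subv0.
(* The first conjunct keeps the derived algebras inside L, where [phi] is known to respect
   brackets. *)
suff [_ le] : (iter k (@derived_alg F n) L <= L)%VS /\
    (iter k (@derived_alg F m) (linfun phi @: L) <=
       linfun phi @: iter k (@derived_alg F n) L)%VS.
  by apply: subv_trans le _; rewrite Lk limg0.
elim: k {Lk} => //= k [kL IHk]; split.
  by apply: subv_trans (derived_algS kL) _; apply: lie_subalgebra_derived.
apply: subv_trans (derived_algS IHk) _; apply/derived_algP.
move=> _ _ /memv_imgP[A AL ->] /memv_imgP[B BL ->].
rewrite !lfunE /= -phiL ?(subvP kL) // -[phi _]lfunE memv_img //.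
exact: mem_derived_alg.
Qed.

End LieImage.

(** Lie's theorem for the action on W in the basis [row_base W]; stability of W makes [conjmx V]
    multiplicative on L. *)
Lemma lie_common_eigenvector_sub (C : numClosedFieldType) n (L : {vspace 'M[C]_n})
    (W : 'M[C]_n) : lie_subalgebra L -> lie_solvable L -> W != 0 ->
    (forall A, A \in L -> stablemx W A) ->
  exists2 v : 'rV[C]_n, (v != 0) && (v <= W)%MS &
    forall A, A \in L -> exists a, v *m A = a *: v.
Proof.
move=> subL solL W0 stW; pose V := row_base W.
have stV A : A \in L -> stablemx V A by rewrite stablemx_row_base; apply: stW.
pose phi : {linear 'M[C]_n -> 'M[C]_(\rank W)} := mulmxr (pinvmx V) \o mulmx V.
have phiE A : phi A = conjmx V A by [].
have phiL A B : A \in L -> B \in L ->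
    phi (lie_bracket A B) = lie_bracket (phi A) (phi B).
  move=> AL BL; rewrite /lie_bracket linearB /= !/(conjmx _ _) -!/(conjmx V _).
  by rewrite !conjmxM ?inE ?stV.
have [|v v0 vP] := lie_common_eigenvector _ (lie_image_subalgebra subL phiL)
  (lie_image_solvable subL phiL solL); first by rewrite lt0n mxrank_eq0.
exists (v *m V) => [|A AL].
  rewrite mulmx_free_eq0 ?row_base_free // v0 /=.
  by rewrite (submx_trans (submxMl _ _)) ?eq_row_base.
have [|a va] := vP (phi A); first by rewrite -[phi A]lfunE memv_img.
exists a; have stE : phi A *m V = V *m A by rewrite phiE /conjmx mulmxKpV ?stV.
by rewrite -mulmxA -stE mulmxA va -scalemxAl.
Qed.

Section Isotropic.
Variables (C : numClosedFieldType) (l : nat).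
Local Notation N := l.*2.
Local Notation J := (so_form C l).

Lemma so_even_mulJ A : A \in so_even C l -> J *m A^T = - (A *m J).
Proof.
by rewrite so_evenE => /eqP->; rewrite mulmxN !mulmxA so_formK mul1mx.
Qed.

Lemma form_skew A (v w : 'rV[C]_N) : A \in so_even C l ->
  v *m A *m J *m w^T = - (v *m J *m (w *m A)^T).
Proof.
move=> /so_even_mulJ AJ.
by rewrite trmx_mul !mulmxA -(mulmxA v J) AJ mulmxN mulNmx opprK !mulmxA.
Qed.

(* Two orthogonal anisotropic eigenvectors have weight zero, and so has an
   isotropic combination of them. *)
Lemma isotropic_row_eigenvector (L : {vspace 'M[C]_N}) : (0 < l)%N ->
    (L <= so_even C l)%VS -> lie_subalgebra L -> lie_solvable L ->
  exists v : 'rV[C]_N, [/\ v != 0, v *m J *m v^T = 0 &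
    forall A, A \in L -> exists a, v *m A = a *: v].
Proof.
move=> l_gt0 /subvP Lso subL solL.
(* Skewness for the form gives 2 a <v, v> = 0 for the weight a. *)
have weight0 (v : 'rV[C]_N) : v *m J *m v^T != 0 ->
    (forall A, A \in L -> exists a, v *m A = a *: v) ->
    forall A, A \in L -> v *m A = 0.
  move=> vv vL A AL; have [a va] := vL A AL.
  have := form_skew v v (Lso _ AL); rewrite va linearZ /= -!scalemxAl -scalemxAr.
  move/eqP; rewrite -addr_eq0 -mulr2n -scaler_nat scalerA scaler_eq0 (negPf vv) orbF.
  by rewrite mulf_eq0 pnatr_eq0 /= => /eqP->; rewrite scale0r.
have [|v v0 vL] := lie_common_eigenvector _ subL solL; first by rewrite double_gt0.
have [vv|vv] := eqVneq (v *m J *m v^T) 0; first by exists v.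
have vA := weight0 v vv vL.
(* The orthogonal of v: stable because L kills v, nonzero because its rank is at least 2l - 1. *)
pose W := kermx (J *m v^T).
have WP (w : 'rV_N) : (w <= W)%MS = (w *m J *m v^T == 0).
  by rewrite sub_kermx mulmxA.
have W0 : W != 0.
  rewrite -mxrank_eq0 mxrank_ker -lt0n subn_gt0.
  apply: leq_ltn_trans (rank_leq_col _) _; lia.
have stW A : A \in L -> stablemx W A.
  move=> AL; apply/rV_subP => _ /submxP[w ->]; rewrite mulmxA.
  by rewrite WP (form_skew _ _ (Lso _ AL)) vA // trmx0 mulmx0 oppr0.
have [w /andP[w0]] := lie_common_eigenvector_sub subL solL W0 stW.
rewrite WP => /eqP wv wL.
have [ww|ww] := eqVneq (w *m J *m w^T) 0; first by exists w.
have wA := weight0 w ww wL.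
have sE (M : 'M[C]_1) : M = (M 0 0)%:M by exact: mx11_scalar.
have n0 (M : 'M[C]_1) : M != 0 -> M 0 0 != 0.
  by apply: contra => /eqP M0; rewrite [M]sE M0 raddf0.
(* A root of <w, w> + t^2 <v, v> = 0, which makes w + t v isotropic since v and w are orthogonal. *)
pose t := sqrtC (- (w *m J *m w^T) 0 0 / (v *m J *m v^T) 0 0).
have tt : t ^+ 2 * (v *m J *m v^T) 0 0 = - (w *m J *m w^T) 0 0.
  by rewrite sqrtCK mulfVK ?n0.
have t0 : t != 0.
  apply/eqP => t0; move/eqP: tt; rewrite t0 expr0n mul0r eq_sym oppr_eq0.
  by rewrite (negPf (n0 _ ww)).
have vw : v *m J *m w^T = 0.
  have <- : (w *m J *m v^T)^T = v *m J *m w^T.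
    by rewrite !trmx_mul trmxK tr_so_form mulmxA.
  by rewrite wv trmx0.
have linE (y : 'rV_N) : (w + t *: v) *m J *m y^T = w *m J *m y^T + t *: (v *m J *m y^T).
  by rewrite !mulmxDl -!scalemxAl.
exists (w + t *: v); split.
- apply/eqP => z; have := linE v; rewrite z !mul0mx wv add0r => /esym/eqP.
  by rewrite scaler_eq0 (negPf t0) (negPf vv).
- rewrite linE linearD linearZ /= !mulmxDr -!scalemxAr wv vw scaler0 addr0 add0r.
  rewrite scalerA -expr2 [w *m _ *m _]sE [v *m _ *m _]sE scale_scalar_mx tt.
  by rewrite -raddfD subrr raddf0.
by move=> A AL; exists 0; rewrite mulmxDl -scalemxAl wA // vA // scaler0 addr0 scale0r.
Qed.

(** Passing to columns by x = J v^T turns the weight a into - a, because J A^T = - A J. *)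
Lemma isotropic_eigenvector (L : {vspace 'M[C]_N}) : (0 < l)%N ->
    (L <= so_even C l)%VS -> lie_subalgebra L -> lie_solvable L ->
  exists x : 'cV[C]_N, [/\ x != 0, x^T *m J *m x = 0 &
    forall A, A \in L -> exists a, A *m x = a *: x].
Proof.
move=> l_gt0 Lso subL solL.
have [v [v0 vv vL]] := isotropic_row_eigenvector l_gt0 Lso subL solL.
exists (J *m v^T); split.
- apply: contraNneq v0 => /(congr1 (mulmx J)).
  by rewrite mulmxA so_formK mul1mx mulmx0 => /(congr1 trmx); rewrite trmxK trmx0 => ->.
- by rewrite trmx_mul trmxK tr_so_form !mulmxA -(mulmxA v) so_formK mulmx1.
move=> A AL; have [a va] := vL A AL; exists (- a).
have := so_even_mulJ (subvP Lso _ AL) => /(congr1 (mulmxr v^T)) /=.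
rewrite mulNmx -!mulmxA -trmx_mul va linearZ /= -scalemxAr => /eqP.
by rewrite eq_sym eqr_oppLR scaleNr => /eqP.
Qed.

End Isotropic.

(** * Moving an isotropic vector to a basis vector by triangular orthogonal elements *)

Section ClearVector.
Variables (F : numFieldType) (l : nat).
Local Notation N := l.*2.
Local Notation J := (so_form F l).
Local Notation e_ j := (delta_mx j 0 : 'cV[F]_N).

Lemma isotropicE (x : 'cV[F]_N) :
  (x^T *m J *m x) 0 0 = \sum_k x (rev_ord k) 0 * x k 0.
Proof. by rewrite mxE; apply: eq_bigr => k _; rewrite mulm_so_form mxE. Qed.

(** The elements [root_elt i p c] clear all coordinates but p and [rev_ord p], for which the root
    vector is zero; that one vanishes by isotropy, as 2 x_p x_(rev p) = 0 remains. Each moves only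
    e_p and e_(rev i) with x_i nonzero, hence the last clause, which protects what is already in
    normal form. *)
Lemma clear_vector (x : 'cV[F]_N) p : x^T *m J *m x = 0 -> x p 0 != 0 ->
    (forall i : 'I_N, (p < i)%N -> x i 0 = 0) ->
  exists u, [/\ orth u, is_trig_mx u^T, u *m x = x p 0 *: e_ p &
    forall r, r != p -> (r != rev_ord p -> x (rev_ord r) 0 = 0) -> u *m e_ r = e_ r].
Proof.
pose S (y : 'cV[F]_N) := [set i | (y i 0 != 0) && (i != p) && (i != rev_ord p)]%SET.
have [d] := ubnP #|S x|; elim: d x => // d IHd x Sx xx xp xgt.
have [S0|[i +]] := finset.set_0Vmem (S x).
  have x0 i : i != p -> i != rev_ord p -> x i 0 = 0.
    move=> ip irp; apply/eqP/negPn/negP => xi.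
    by have := finset.in_set0 i; rewrite -S0 !inE xi ip irp.
  exists 1%:M; split; [exact: orth1|exact: uptri1| |by move=> r _ _; rewrite mul1mx].
  rewrite mul1mx; have : (x^T *m J *m x) 0 0 = 0 by rewrite xx mxE.
  rewrite isotropicE (bigD1 p) //= (bigD1 (rev_ord p)) ?rev_ord_neq //= rev_ordK.
  rewrite big1 ?addr0 => [|k /andP[kp krp]]; last by rewrite (x0 k) ?mulr0.
  rewrite mulrC -mulr2n => /eqP; rewrite mulrn_eq0 /= mulf_eq0 (negPf xp) /= => /eqP xrp.
  apply/colP => i; rewrite !mxE eqxx andbT.
  have [->|ip] := eqVneq i p; first by rewrite mulr1.
  rewrite mulr0; have [->//|irp] := eqVneq i (rev_ord p); exact: x0.
rewrite !inE => /andP[/andP[xi ip] irp].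
have lt_ip : (i < p)%N.
  rewrite ltn_neqAle (inj_eq val_inj) ip /= leqNgt.
  by apply: contra xi => /xgt->.
pose c := - (x i 0 / x p 0); pose y := root_elt i p c *m x.
have yE a : y a 0 = x a 0 + c * ((a == i)%:R * x p 0 - (a == rev_ord p)%:R * x (rev_ord i) 0).
  by rewrite root_eltE.
have oR := root_elt_orth c ip.
have yp : y p 0 = x p 0.
  by rewrite yE eq_sym (negPf ip) eq_sym (negPf (rev_ord_neq p)) !mul0r subr0 mulr0 addr0.
have yi : y i 0 = 0.
  by rewrite yE eqxx (negPf irp) mul0r subr0 mul1r /c mulNr divfK // subrr.
have y_eq a : a != i -> a != rev_ord p -> y a 0 = x a 0.
  by move=> /negPf ai /negPf arp; rewrite yE ai arp !mul0r subr0 mulr0 addr0.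
have Syx : S y \proper S x.
  apply/properP; split; last by exists i; rewrite !inE ?xi ?ip ?irp // yi eqxx.
  apply/fintype.subsetP => a; rewrite !inE => /andP[/andP[ya ap] arp]; rewrite ap arp !andbT.
  by rewrite -y_eq //; apply: contraNneq ya => ->; rewrite yi.
have yy : y^T *m J *m y = 0.
  by rewrite /y trmx_mul -!mulmxA (mulmxA J) (mulmxA _ _ x) [_ *m (J *m _)]mulmxA oR mulmxA.
have ygt (a : 'I_N) : (p < a)%N -> y a 0 = 0.
  move=> pa; rewrite yE (xgt a pa) add0r (_ : (a == i) = false); last first.
    by apply/negbTE; rewrite -(inj_eq val_inj) /= gtn_eqF // (ltn_trans lt_ip).
  have [arp|_] := eqVneq a (rev_ord p); last by rewrite !mul0r subr0 mulr0.
  rewrite mul0r mul1r sub0r xgt ?oppr0 ?mulr0 //.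
  by apply: ltn_trans pa _; rewrite arp ltn_rev_ord.
have yp0 : y p 0 != 0 by rewrite yp.
have [|u [ou ut uy ufix]] := IHd y _ yy yp0 ygt.
  by apply: leq_trans (proper_card Syx) _.
exists (u *m root_elt i p c); split.
- exact: orthM.
- by apply: uptriM => //; apply: root_elt_uptri.
- by rewrite -mulmxA uy yp.
move=> r rp xr; have Re : root_elt i p c *m e_ r = e_ r.
  have pr : (p == r) = false by rewrite eq_sym (negPf rp).
  apply/colP => a; rewrite root_eltE [e_ r p 0]mxE pr mulr0 sub0r.
  rewrite [e_ r (rev_ord i) 0]mxE andbT; have [ir|_] := eqVneq (rev_ord i) r; last first.
    by rewrite mulr0 oppr0 mulr0 addr0.
  case/negP: xi; rewrite -(rev_ordK i) ir xr //.
  by rewrite -ir (inj_eq rev_ord_inj).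
rewrite -mulmxA Re ufix // => rrp.
have [ri|ri] := eqVneq (rev_ord r) i; first by rewrite ri yi.
by rewrite y_eq ?xr // (inj_eq rev_ord_inj).
Qed.

End ClearVector.

(** * Borel subalgebras *)

Section MiddleBlock.
Variables (l k : nat).

Fact mid_ord_proof (i : 'I_((l - k).*2)) : (i + k < l.*2)%N.
Proof. by have := ltn_ord i; lia. Qed.

Definition mid_ord i : 'I_(l.*2) := Ordinal (mid_ord_proof i).

Lemma mid_ord_inj : injective mid_ord.
Proof. by move=> i j /(congr1 val) /= /eqP; rewrite eqn_add2r => /eqP/val_inj. Qed.

Lemma mid_ord_rev i : mid_ord (rev_ord i) = rev_ord (mid_ord i).
Proof. by apply: val_inj => /=; have := ltn_ord i; lia. Qed.

Definition is_mid (a : 'I_(l.*2)) := (k <= a)%N && (k <= rev_ord a)%N.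

Lemma is_mid_rev a : is_mid (rev_ord a) = is_mid a.
Proof. by rewrite /is_mid rev_ordK andbC. Qed.

Lemma mid_ord_mid i : is_mid (mid_ord i).
Proof. by rewrite /is_mid -mid_ord_rev /= !leq_addl. Qed.

Lemma is_midP a : reflect (exists i, a = mid_ord i) (is_mid a).
Proof.
apply: (iffP andP) => [[ka kra]|[i ->]]; last exact/andP/mid_ord_mid.
have ia : (a - k < (l - k).*2)%N by move: kra (ltn_ord a) => /=; lia.
by exists (Ordinal ia); apply: val_inj => /=; rewrite subnK.
Qed.

Lemma sum_mid (V : nmodType) (G : 'I_(l.*2) -> V) :
  (forall a, ~~ is_mid a -> G a = 0) -> \sum_a G a = \sum_i G (mid_ord i).
Proof.
move=> G0; rewrite (bigID is_mid) /= [X in _ + X]big1 // addr0.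
rewrite -(big_imset G (A := predT)) /=; last by move=> i j _ _; apply: mid_ord_inj.
apply: eq_bigl => a; apply/is_midP/imsetP => [[i ->]|[i _ ->]]; by exists i.
Qed.

End MiddleBlock.

Section Triangularization.
Variables (C : numClosedFieldType) (l : nat).
Local Notation N := l.*2.
Local Notation J := (so_form C l).
Local Notation e_ j := (delta_mx j 0 : 'cV[C]_N).

Definition tri_upto k (A : 'M[C]_N) := forall i j : 'I_N, (j < k)%N -> (j < i)%N -> A i j = 0.

(** Reflection in the antidiagonal exchanges the first k columns and the last k rows. *)
Lemma tri_upto_row k A (i j : 'I_N) : A \in so_even C l -> tri_upto k A ->
  (rev_ord i < k)%N -> (j < i)%N -> A i j = 0.
Proof.
move=> /so_evenP As At ik ji; rewrite -(rev_ordK i) -(rev_ordK j) As At ?oppr0 //.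
by rewrite ltn_rev_ord.
Qed.

(** A summation index before the block kills the factor from A, one after it kills the factor from
    B. So the middle block is a Lie homomorphism on these matrices. *)
Lemma mid_block_mul k A B : A \in so_even C l -> B \in so_even C l ->
    tri_upto k A -> tri_upto k B ->
  mxsub (mid_ord (k:=k)) (mid_ord (k:=k)) (A *m B) =
  mxsub (mid_ord (k:=k)) (mid_ord (k:=k)) A *m mxsub (mid_ord (k:=k)) (mid_ord (k:=k)) B.
Proof.
move=> As Bs At Bt; apply/matrixP => i j; rewrite !mxE (sum_mid (k:=k)).
  by apply: eq_bigr => a _; rewrite !mxE.
have /andP[kj krj] := mid_ord_mid j; have /andP[ki kri] := mid_ord_mid i.
move=> a; rewrite negb_and -!ltnNge => /orP[ak|rak].
  by rewrite At ?mul0r //; apply: leq_trans ak _.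
rewrite (tri_upto_row Bs Bt rak) ?mulr0 //.
by rewrite -ltn_rev_ord; apply: leq_trans rak _.
Qed.

Lemma mid_block_so k A : A \in so_even C l ->
  mxsub (mid_ord (k:=k)) (mid_ord (k:=k)) A \in so_even C (l - k).
Proof.
by move=> /so_evenP As; apply/so_evenP => i j; rewrite !mxE !mid_ord_rev As.
Qed.

(** An orthogonal exchange of k and p must exchange their opposites too; for p = [rev_ord k] the two
    transpositions coincide and their product would be trivial. *)
Definition sub_swap (k p : 'I_N) : {perm 'I_N} :=
  if p == rev_ord k then tperm k p else (tperm k p * tperm (rev_ord k) (rev_ord p))%g.

Lemma sub_swap_rev k p i : sub_swap k p (rev_ord i) = rev_ord (sub_swap k p i).
Proof.
have rt a b c : rev_ord (tperm a b c) = tperm (rev_ord a) (rev_ord b) (rev_ord c) :> 'I_N.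
  exact: inj_tperm rev_ord_inj.
rewrite /sub_swap; case: eqP => [->|/eqP prk].
  by rewrite rt rev_ordK tpermC.
rewrite !permM !rt !rev_ordK.
have prk' : rev_ord p != k by apply: contraNneq prk => <-; rewrite rev_ordK.
have [->|kp] := eqVneq p k; first by rewrite !tperm1 !perm1.
have com : commute (tperm k p) (tperm (rev_ord k) (rev_ord p)).
  apply/commgP/conjg_fixP; rewrite tpermJ !tpermD // ?rev_ord_neq // 1?eq_sym //.
by rewrite -!permM com.
Qed.

Lemma sub_swapL k p : sub_swap k p k = p.
Proof.
rewrite /sub_swap; case: eqP => [_|/eqP prk]; first by rewrite tpermL.
by rewrite permM tpermL tpermD // ?rev_ord_neq // eq_sym.
Qed.

Lemma sub_swapD k p i : i != k -> i != p -> i != rev_ord k -> i != rev_ord p ->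
  sub_swap k p i = i.
Proof.
move=> ik ip irk irp; rewrite /sub_swap.
by case: ifP => _; rewrite ?permM !tpermD // 1?eq_sym // tpermD // 1?eq_sym.
Qed.

(** With F spanned by the first k basis vectors, the middle block is the action on the orthogonal of
    F modulo F. An isotropic eigenvector there lifts to y, which an orthogonal h fixing the basis
    vectors outside the block moves to a multiple of the basis vector of index k. *)
Lemma triangularize_step k (L : {vspace 'M[C]_N}) : (k < l)%N ->
    (L <= so_even C l)%VS -> lie_subalgebra L -> lie_solvable L ->
    (forall A, A \in L -> tri_upto k A) ->
  exists2 h : 'M[C]_N, orth h & forall A, A \in Ad h L -> tri_upto k.+1 A.
Proof.
move=> kl /subvP Lso subL solL Lt.
pose f := @mid_ord l k.
pose phi : {linear 'M[C]_N -> 'M[C]_((l - k).*2)} := mxsub f f.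
have phiL A B : A \in L -> B \in L ->
    phi (lie_bracket A B) = lie_bracket (phi A) (phi B).
  move=> AL BL; rewrite /lie_bracket linearB /=.
  by rewrite !mid_block_mul; do ?[exact: Lso|exact: Lt].
have [||x [x0 xx xL]] := isotropic_eigenvector _ _ (lie_image_subalgebra subL phiL)
  (lie_image_solvable subL phiL solL).
- by rewrite subn_gt0.
- by apply/subvP => _ /memv_imgP[A AL ->]; rewrite lfunE /= mid_block_so ?Lso.
pose y : 'cV[C]_N := \col_a \sum_(i | f i == a) x i 0.
have yf i : y (f i) 0 = x i 0.
  by rewrite mxE (big_pred1 i) // => j; rewrite (inj_eq (@mid_ord_inj _ _)).
have y0 a : ~~ is_mid k a -> y a 0 = 0.
  move=> na; rewrite mxE big_pred0 // => i.
  by apply: contraNF na => /eqP<-; apply: mid_ord_mid.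
clearbody y.
have yy : y^T *m J *m y = 0.
  rewrite [LHS]mx11_scalar isotropicE (sum_mid (k:=k)) => [|a na]; last first.
    by rewrite (y0 a) ?mulr0.
  rewrite (eq_bigr (fun i => x (rev_ord i) 0 * x i 0)) => [|i _]; last first.
    by rewrite -mid_ord_rev !yf.
  by rewrite -isotropicE xx mxE raddf0.
(* An eigenvector only modulo the first k basis vectors, which is all that triangularity of column k
   asks for. *)
have yA A : A \in L -> exists a, forall i : 'I_N, (k <= i)%N -> (A *m y) i 0 = a * y i 0.
  move=> AL; have [|a xa] := xL (phi A); first by rewrite -[phi A]lfunE memv_img.
  exists a => i ki.
  have -> : (A *m y) i 0 = \sum_j A i (f j) * x j 0.
    rewrite mxE (sum_mid (k:=k)) => [|b nb]; last by rewrite y0 ?mulr0.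
    by apply: eq_bigr => j _; rewrite yf.
  have [im|nim] := boolP (is_mid k i).
    have [j ->] := is_midP _ _ im; rewrite yf.
    have /colP/(_ j) := xa; rewrite !mxE => <-.
    by apply: eq_bigr => b _; rewrite mxE.
  rewrite y0 // mulr0 big1 // => j _.
  move: nim; rewrite negb_and -!ltnNge ltnNge ki /= => rik.
  rewrite (tri_upto_row (Lso _ AL) (Lt _ AL) rik) ?mul0r //.
  have /andP[_ krj] := mid_ord_mid j.
  by rewrite -ltn_rev_ord; apply: leq_trans rik _.
have [i0 yi0] : exists i, y i 0 != 0.
  have [j xj] : exists j, x j 0 != 0.
    by have /cV0Pn := x0.
  by exists (f j); rewrite yf.
case: (@arg_maxnP _ i0 (fun i => y i 0 != 0) (@nat_of_ord N) yi0) => p yp max_p.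
have ygt (i : 'I_N) : (p < i)%N -> y i 0 = 0.
  by move=> pi; apply/eqP/negPn/negP => /max_p /=; rewrite leqNgt pi.
have midp : is_mid k p by apply: contraNT yp => /y0->.
have [u [ou ut uy ufix]] := clear_vector yy yp ygt.
have kN : (k < N)%N by lia.
pose kk : 'I_N := Ordinal kN.
have midk : is_mid k kk by rewrite /is_mid /=; lia.
(* First y goes to a multiple of e_p, then e_p to e_k; h is orthogonal but need not be
   triangular. *)
pose h := perm_mx (sub_swap kk p) *m u.
have oh : orth h by apply: orthM ou; apply/perm_mx_orth/sub_swap_rev.
have hy : h *m y = y p 0 *: e_ kk.
  by rewrite /h -mulmxA uy -scalemxAr -{3}(sub_swapL kk p) perm_mx_delta.
have hfix r : ~~ is_mid k r -> h *m e_ r = e_ r.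
  move=> nr; have neq a : is_mid k a -> r != a by move=> am; apply: contraNneq nr => ->.
  have -> : h *m e_ r = perm_mx (sub_swap kk p) *m e_ r.
    by rewrite /h -mulmxA ufix => [//||_]; [apply: neq|rewrite y0 ?is_mid_rev].
  have sr : sub_swap kk p r = r by apply: sub_swapD; apply: neq; rewrite ?is_mid_rev.
  by rewrite -{1}sr perm_mx_delta.
clearbody h; have uh := orth_unit oh.
have nmid (a : 'I_N) : (a < k)%N -> ~~ is_mid k a by rewrite ltnNge /is_mid; case: (k <= a)%N.
have hlow (z : 'cV_N) : (forall i : 'I_N, (k <= i)%N -> z i 0 = 0) -> h *m z = z.
  move=> z0; rewrite (sum_delta z) mulmx_sumr; apply: eq_bigr => a _.
  rewrite -scalemxAr; have [ka|ak] := leqP k a; first by rewrite z0 ?scale0r.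
  by rewrite hfix ?nmid.
have hV z : h *m z = z -> invmx h *m z = z.
  by move=> hz; rewrite -{1}hz mulKmx ?orth_unit.
have entryE (M : 'M[C]_N) i j : M i j = (M *m e_ j) i 0 by rewrite -colE mxE.
exists h => // A; rewrite mem_Ad ?orth_unit //.
set B := _ *m h => BL i j; rewrite ltnS => jk ji.
have AE (z : 'cV_N) : A *m z = h *m (B *m (invmx h *m z)).
  by rewrite /B !mulmxA (mulmxV uh) mul1mx (mulmxK uh).
rewrite entryE AE; move: jk; rewrite leq_eqVlt => /predU1P[jk|jk].
  have -> : j = kk by apply: val_inj.
  have -> : e_ kk = (y p 0)^-1 *: (h *m y) by rewrite hy scalerK.
  have [a Ba] := yA B BL.
  rewrite -scalemxAr mulKmx ?orth_unit // -scalemxAr.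
  have z0 (b : 'I_N) : (k <= b)%N -> (B *m y - a *: y) b 0 = 0.
    by move=> kb; rewrite mxE Ba // [X in _ + X]mxE [X in _ - X]mxE subrr.
  rewrite -[B *m y](subrK (a *: y)) scalerDr mulmxDr hlow => [|b kb]; last first.
    by rewrite mxE z0 ?mulr0.
  rewrite -!scalemxAr hy mxE [X in X + _]mxE z0; last by rewrite -jk ltnW.
  have /negPf ik : i != kk by apply: contraTneq ji => ->; rewrite /= jk ltnn.
  by rewrite !mxE ik !mulr0 addr0.
rewrite hV; last by rewrite hfix ?nmid.
rewrite hlow => [|b kb]; last by rewrite -entryE Lt // (leq_trans jk).
by rewrite -entryE Lt.
Qed.

Theorem solvable_sub_Ad_so_borel (L : {vspace 'M[C]_N}) :
    (L <= so_even C l)%VS -> lie_subalgebra L -> lie_solvable L ->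
  exists2 g : 'M[C]_N, orth g & (L <= Ad g (so_borel C l))%VS.
Proof.
move=> Lso subL solL.
suff /(_ l (leqnn l)) [h oh ht] : forall k, (k <= l)%N ->
    exists2 h, orth h & forall A, A \in Ad h L -> tri_upto k A.
  exists (invmx h); first exact: orthV.
  rewrite -(AdK L (orth_unit oh)); apply: AdS; first by rewrite unitmx_inv orth_unit.
  apply/subvP => A AL; have As : A \in so_even C l.
    by rewrite -(Ad_so_even oh) (subvP (AdS (orth_unit oh) Lso)).
  rewrite mem_so_borel As /=; apply/uptriP => i j ji.
  have [jl|lj] := ltnP j l; first exact: ht _ AL _ _ jl ji.
  (* Below the diagonal and from column l on, the row i has [rev_ord i] < l. *)
  by apply: (tri_upto_row As (ht _ AL)) => //=; have := ltn_ord i; lia.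
elim=> [_|k IHk kl].
  by exists 1%:M => [|A _ i j]; first exact: orth1.
have [h oh ht] := IHk (ltnW kl); have uh := orth_unit oh.
have [|||h' oh' ht'] := @triangularize_step k (Ad h L) kl _ _ _ ht.
- by rewrite -(Ad_so_even oh); apply: AdS.
- exact: Ad_subalgebra.
- exact: Ad_solvable.
by exists (h' *m h); [exact: orthM|rewrite Ad_mul ?orth_unit].
Qed.

(** Maximality is by dimension: a larger solvable subalgebra would fit in a conjugate of
    [so_borel]. *)
Lemma so_borel_borel : borel_subalgebra (so_even C l) (so_borel C l).
Proof.
split; [exact: capvSl|exact: so_borel_subalgebra|exact: so_borel_solvable|].
move=> c cso subc solc bc; have [g og cg] := solvable_sub_Ad_so_borel cso subc solc.
apply/esym/eqP; rewrite eqEdim bc.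
by apply: leq_trans (dimvS cg) _; rewrite dim_Ad ?orth_unit.
Qed.

Theorem flag_varietyE :
  flag_variety (so_even C l) = [set Ad g (so_borel C l) | g in @orth C l]%classic.
Proof.
apply/seteqP; split=> [b [bso subb solb maxb]|_ [g og <-]].
  have [g og bg] := solvable_sub_Ad_so_borel bso subb solb.
  have ug := orth_unit og; exists g => //; apply: maxb => //.
  - by rewrite -(Ad_so_even og); apply: AdS (capvSl _ _).
  - exact: (Ad_subalgebra ug (@so_borel_subalgebra _ _)).
  - exact: (Ad_solvable ug (so_borel_solvable _ _)).
have [bso subb solb maxb] := so_borel_borel; have ug := orth_unit og; split.
- by rewrite -(Ad_so_even og); apply: AdS.
- exact: Ad_subalgebra.
- exact: Ad_solvable.
move=> c cso subc solc gc; rewrite -(AdKV c ug); congr (Ad g _).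
have og' := orthV og; have ug' := orth_unit og'; apply: maxb.
- by rewrite -(Ad_so_even og'); apply: AdS.
- exact: Ad_subalgebra.
- exact: Ad_solvable.
by rewrite -(AdK (so_borel C l) ug); apply: AdS.
Qed.

End Triangularization.

(** * The Bruhat decomposition *)

Section Bruhat.
Variables (F : numFieldType) (l : nat).
Local Notation N := l.*2.
Local Notation J := (so_form F l).
Local Notation e_ j := (delta_mx j 0 : 'cV[F]_N).
Implicit Types g h b : 'M[F]_N.

Lemma mul_deltaE g i j : (g *m e_ j) i 0 = g i j.
Proof. by rewrite -colE mxE. Qed.

Definition monomial_col g j := exists r c, c != 0 /\ g *m e_ j = c *: e_ r.

Lemma monomial_colE g j r c i : g *m e_ j = c *: e_ r -> g i j = c * (i == r)%:R.
Proof. by move=> gj; rewrite -mul_deltaE gj !mxE andbT. Qed.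

(** Pairing column j with column m leaves the single row [rev_ord r]. A monomial column thus forces
    a monomial row, at the opposite of its pivot. *)
Lemma monomial_row g j r c m : orth g -> c != 0 -> g *m e_ j = c *: e_ r ->
  c * g (rev_ord r) m = (m == rev_ord j)%:R.
Proof.
move=> og c0 gj; rewrite -(orth_col _ _ og) (bigD1 (rev_ord r)) //= big1 => [|k kr].
  by rewrite addr0 rev_ordK (monomial_colE _ gj) eqxx mulr1.
rewrite (monomial_colE _ gj) (_ : (rev_ord k == r) = false) ?mulr0 ?mul0r //.
by apply: contraNF kr => /eqP<-; rewrite rev_ordK.
Qed.

Lemma monomial_col_rev g j r c r' c' : orth g -> c != 0 ->
  g *m e_ j = c *: e_ r -> g *m e_ (rev_ord j) = c' *: e_ r' -> r' = rev_ord r.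
Proof.
move=> og c0 gj gj'; have := monomial_row (rev_ord j) og c0 gj.
rewrite eqxx (monomial_colE _ gj'); case: eqP => // _ /eqP.
by rewrite !mulr0 eq_sym oner_eq0.
Qed.

Lemma monomial_row0 g j r c m : orth g -> c != 0 -> g *m e_ j = c *: e_ r ->
  monomial_col g (rev_ord j) -> m != j -> g r m = 0.
Proof.
move=> og c0 gj [r' [c' [c'0 gj']]] mj.
have := monomial_row m og c'0 gj'; rewrite (monomial_col_rev og c0 gj gj') !rev_ordK.
by rewrite (negPf mj) => /eqP; rewrite mulf_eq0 (negPf c'0) => /eqP.
Qed.

Lemma monomial_col_inv g j r c : g \in unitmx -> c != 0 -> g *m e_ j = c *: e_ r ->
  invmx g *m e_ r = c^-1 *: e_ j.
Proof. by move=> ug c0 gj; rewrite -(mulKmx ug (e_ j)) gj scalemxAr scalerA mulVf ?scale1r. Qed.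

Lemma orth_col_isotropic g j : orth g -> (g *m e_ j)^T *m J *m (g *m e_ j) = 0.
Proof.
move=> og; rewrite [LHS]mx11_scalar isotropicE; under eq_bigr do rewrite !mul_deltaE.
by rewrite orth_col // eq_sym (negPf (rev_ord_neq j)) raddf0.
Qed.

(** The elimination goes from both ends towards the middle, since orthogonality couples opposite
    columns. *)
Definition outer k (j : 'I_N) := (j < k)%N || (rev_ord j < k)%N.

Lemma outer_rev k j : outer k (rev_ord j) = outer k j.
Proof. by rewrite /outer rev_ordK orbC. Qed.

(* Clearing the column of a pivot row p, then the row of p through the inverse. *)
Lemma bruhat_step k g : (k < l)%N -> orth g -> (forall j, outer k j -> monomial_col g j) ->
  exists u u', [/\ orth u /\ is_trig_mx u^T, orth u' /\ is_trig_mx u'^T &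
    forall j, outer k.+1 j -> monomial_col (u *m g *m u') j].
Proof.
move=> kl og gK; have ug := orth_unit og.
have kN : (k < N)%N by lia.
pose q : 'I_N := Ordinal kN.
have Kq : ~~ outer k q by rewrite /outer /=; lia.
have Kq' : ~~ outer k (rev_ord q) by rewrite outer_rev.
have neqK a j : ~~ outer k a -> outer k j -> a != j.
  by move=> na; apply: contraTneq => <-.
pose x := g *m e_ q.
have [i0 xi0] : exists i, x i 0 != 0.
  apply/cV0Pn/eqP => x0; have /eqP := orth_col q (rev_ord q) og; rewrite eqxx.
  rewrite big1 ?(eq_sym 0) ?oner_eq0 // => i _.
  by rewrite -mul_deltaE -/x x0 mxE mul0r.
case: (@arg_maxnP _ i0 (fun i => x i 0 != 0) (@nat_of_ord N) xi0) => p xp max_p.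
have xgt (i : 'I_N) : (p < i)%N -> x i 0 = 0.
  by move=> pi; apply/eqP/negPn/negP => /max_p /=; rewrite leqNgt pi.
have [u [ou ut ux ufix]] := clear_vector (orth_col_isotropic q og) xp xgt.
pose g1 := u *m g; have og1 : orth g1 by apply: orthM.
have ug1 := orth_unit og1.
have g1q : g1 *m e_ q = x p 0 *: e_ p by rewrite -mulmxA ux.
have g1K j r c : outer k j -> c != 0 -> g *m e_ j = c *: e_ r ->
    g1 *m e_ j = c *: e_ r /\ r != p.
  move=> Kj c0 gj.
  have rp : r != p.
    apply: contraNneq xp => <-; rewrite mul_deltaE.
    rewrite (monomial_row0 og c0 gj) //; last exact: neqK.
    by apply: gK; rewrite outer_rev.
  split=> //; rewrite /g1 -mulmxA gj -scalemxAr ufix // => _.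
  rewrite mul_deltaE; have := monomial_row q og c0 gj.
  by rewrite (negPf (neqK _ _ Kq _)) ?outer_rev // => /eqP; rewrite mulf_eq0 (negPf c0) => /eqP.
pose h := invmx g1; have oh : orth h by apply: orthV.
have uh := orth_unit oh.
have hp : h *m e_ p = (x p 0)^-1 *: e_ q by apply: monomial_col_inv.
(* Row p of g1 read backwards; its last nonzero entry is at [rev_ord q], because the row vanishes in
   the columns already treated. *)
pose x' := h *m e_ (rev_ord p).
have x'E a : x' a 0 = g1 p (rev_ord a) by rewrite mul_deltaE orth_invmxE // rev_ordK.
have xp' : x' (rev_ord q) 0 != 0.
  by rewrite x'E rev_ordK (monomial_colE _ g1q) eqxx mulr1.
have x'K j : outer k j -> x' j 0 = 0.
  move=> Kj; rewrite x'E.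
  have [r [c [c0 gj]]] := gK (rev_ord j) (etrans (outer_rev _ _) Kj).
  have [|gj1 rp] := g1K _ _ _ _ c0 gj; first by rewrite outer_rev.
  by rewrite (monomial_colE _ gj1) eq_sym (negPf rp) mulr0.
have xgt' (i : 'I_N) : (rev_ord q < i)%N -> x' i 0 = 0.
  move=> qi; apply: x'K; rewrite /outer; apply/orP; right.
  by rewrite -[k]/(nat_of_ord q) -ltn_rev_ord rev_ordK.
have [u' [ou' ut' ux' ufix']] := clear_vector (orth_col_isotropic (rev_ord p) oh) xp' xgt'.
have uu' := orth_unit ou'.
exists u, (invmx u'); split=> //; first by split; [apply: orthV|apply: uptri_orthV].
have inv_col (a b : 'I_N) (d : F) : d != 0 ->
    u' *m h *m e_ b = d *: e_ a -> monomial_col (g1 *m invmx u') a.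
  move=> d0 hb; exists b, d^-1; split; first by rewrite invr_eq0.
  have -> : g1 *m invmx u' = invmx (u' *m h) by rewrite invmx_mul // /h invmxK.
  by apply: monomial_col_inv => //; rewrite unitmx_mul uu'.
move=> j; have [Kj _|nKj Kj] := boolP (outer k j); last first.
  have [->|->] : j = q \/ j = rev_ord q.
    move: nKj Kj; rewrite /outer => nKj Kj.
    have [jq|jq] : nat_of_ord j = k \/ nat_of_ord (rev_ord j) = k by lia.
      by left; apply: val_inj.
    by right; apply: rev_ord_inj; rewrite rev_ordK; apply: val_inj.
  - apply: (inv_col _ p (x p 0)^-1); first by rewrite invr_eq0.
    rewrite -mulmxA hp -scalemxAr ufix' ?rev_ordK ?eqxx //.
    by rewrite eq_sym rev_ord_neq.
  - by apply: (inv_col _ (rev_ord p) _ xp'); rewrite -mulmxA ux'.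
have [r [c [c0 gj]]] := gK _ Kj; have [gj1 rp] := g1K _ _ _ Kj c0 gj.
apply: (inv_col _ r c^-1); first by rewrite invr_eq0.
rewrite -mulmxA (monomial_col_inv ug1 c0 gj1) -scalemxAr ufix' //.
  by rewrite eq_sym neqK.
by move=> _; rewrite x'K ?outer_rev.
Qed.

Theorem bruhat g : orth g -> exists b b' (s : {perm 'I_N}),
  [/\ orth b /\ is_trig_mx b^T, orth b' /\ is_trig_mx b'^T,
      forall i, s (rev_ord i) = rev_ord (s i) & g = b *m perm_mx s *m b'].
Proof.
move=> og.
have : forall k, (k <= l)%N -> exists u u',
    [/\ orth u /\ is_trig_mx u^T, orth u' /\ is_trig_mx u'^T &
    forall j, outer k j -> monomial_col (u *m g *m u') j].
  elim=> [_|k IHk kl].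
    exists 1%:M, 1%:M; split; rewrite ?mul1mx ?mulmx1 //;
    by split; [apply: orth1|apply: uptri1].
  have [u [u' [[ou ut] [ou' ut'] mono]]] := IHk (ltnW kl).
  have og1 : orth (u *m g *m u') by do 2![apply: orthM => //].
  have [v [v' [[ov vt] [ov' vt'] mono']]] := bruhat_step kl og1 mono.
  exists (v *m u), (u' *m v'); split; do ?[by split; [apply: orthM|apply: uptriM]].
  by rewrite !mulmxA in mono' *.
move=> /(_ l (leqnn l)) [u [u' [[ou ut] [ou' ut'] mono]]].
pose n := u *m g *m u'; have on : orth n by do 2![apply: orthM => //].
have un := orth_unit on.
have {}mono j : exists rc : 'I_N * F, rc.2 != 0 /\ n *m e_ j = rc.2 *: e_ rc.1.
  have [|r [c rc]] := mono j; last by exists (r, c).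
  by rewrite /outer /=; have := ltn_ord j; lia.
have [f fP] := choice mono; pose r j := (f j).1; pose c j := (f j).2.
have c0 j : c j != 0 by case: (fP j).
have nj j : n *m e_ j = c j *: e_ (r j) by case: (fP j).
have r_inj : injective r.
  move=> i j rij; apply/eqP; apply: contraT => ij.
  have /colP/(_ i) : e_ i = (c i / c j) *: e_ j.
    rewrite -(mulKmx un (e_ i)) -(mulKmx un (e_ j)) !nj rij -!scalemxAr scalerA.
    by rewrite divfK.
  by rewrite !mxE eqxx (negPf ij) mulr0 => /eqP; rewrite oner_eq0.
(* The inverse of the pivot map r, since [perm_mx s] sends e_(s i) to e_i. *)
pose s := (perm r_inj)^-1%g.
have sr j : s (r j) = j by rewrite -(permE r_inj) permK.
have s_rev i : s (rev_ord i) = rev_ord (s i).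
  have -> : i = r (s i) by rewrite -(permE r_inj) permKV.
  by rewrite -(monomial_col_rev on (c0 _) (nj _) (nj _)) !sr.
have os := perm_mx_orth F s_rev; have us := orth_unit os.
(* A diagonal matrix, absorbed in the right triangular factor. *)
pose t := invmx (perm_mx s) *m n.
have ot : orth t by apply: orthM => //; apply: orthV.
have tt : is_trig_mx t^T.
  apply/uptriP => i j ji; rewrite -mul_deltaE /t -mulmxA nj -scalemxAr.
  rewrite -(perm_mx_delta F s (r j)) mulKmx // sr !mxE andbT.
  by rewrite -val_eqE /= gtn_eqF // mulr0.
exists (invmx u), (t *m invmx u'), s; split=> //.
- by split; [apply: orthV|apply: uptri_orthV].
- by split; [apply: orthM => //; apply: orthV|apply: uptriM => //; apply: uptri_orthV].
by rewrite /t /n !mulmxA (mulmxK us) mulVmx ?orth_unit // mul1mx mulmxK ?orth_unit.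
Qed.

End Bruhat.

(** * The normalizer of the upper triangular Borel subalgebra *)

(** The quotient t^-1 s never increases an index, so by strong induction it is the identity. *)
Lemma perm_le_eq n (s t : {perm 'I_n}) : (forall i, s i <= t i)%N -> s = t.
Proof.
move=> st; pose r := (t^-1 * s)%g.
have rle i : (r i <= i)%N by rewrite permM -{2}(permKV t i); apply: st.
have r1 i : r i = i.
  have [m] := ubnP i; elim: m i => // m IHm i; rewrite ltnS => im.
  have := rle i; rewrite leq_eqVlt => /predU1P[/val_inj//|lt].
  by apply: (@perm_inj _ r); apply: IHm; apply: leq_trans lt im.
by apply/permP => i; have := r1 (t i); rewrite permM permK.
Qed.

Lemma invmx_perm (F : fieldType) n (s : {perm 'I_n}) :
  invmx (perm_mx s) = perm_mx s^-1 :> 'M[F]_n.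
Proof.
have us : (perm_mx s : 'M[F]_n) \in unitmx by exact: unitmx_perm.
by rewrite -[RHS](mulKmx us) -perm_mxM mulgV perm_mx1 mulmx1.
Qed.

Section Normalizer.
Variables (F : numFieldType) (l : nat) (l_gt0 : (0 < l)%N).
Local Notation N := l.*2.
Local Notation J := (so_form F l).
Implicit Types g h b n : 'M[F]_N.

Fact pos_l_proof : (l.-1 < l.*2)%N.
Proof. by move: l_gt0; lia. Qed.
Definition pos_l : 'I_N := Ordinal pos_l_proof.
Definition neg_l : 'I_N := rev_ord pos_l.

Lemma neg_lE : neg_l = l :> nat.
Proof. by move: l_gt0 => /=; lia. Qed.

Lemma pos_l_lt_neg_l : (pos_l < neg_l)%N.
Proof. by rewrite neg_lE /=; move: l_gt0; lia. Qed.

Lemma neg_l_neq_pos_l : neg_l != pos_l.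
Proof. exact: rev_ord_neq. Qed.

Lemma between_pos_neg_l (i : 'I_N) : (pos_l <= i)%N -> (i <= neg_l)%N -> i = pos_l \/ i = neg_l.
Proof.
rewrite neg_lE /= => mi im; have [|] : (i = l.-1 :> nat) \/ (i = l :> nat) by move: l_gt0; lia.
  by move=> ie; left; apply: val_inj.
by move=> ie; right; apply: val_inj; rewrite /= ie -[RHS]/(nat_of_ord neg_l) neg_lE.
Qed.

Lemma le_pos_lE (i : 'I_N) : (i <= pos_l)%N = (i < l)%N.
Proof. by move: l_gt0 => /=; lia. Qed.

Lemma rev_neg_l : rev_ord neg_l = pos_l. Proof. exact: rev_ordK. Qed.

(** The matrix of this transposition lies in O(2l) but not in SO(2l), and still normalizes
    [so_borel]. *)
Definition mid_swap : {perm 'I_N} := tperm pos_l neg_l.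

Lemma mid_swap_rev i : mid_swap (rev_ord i) = rev_ord (mid_swap i).
Proof. by rewrite (inj_tperm _ _ _ rev_ord_inj) rev_neg_l tpermC. Qed.

Lemma mid_swapP i : i != pos_l -> i != neg_l -> mid_swap i = i.
Proof. by move=> i1 i2; rewrite tpermD // eq_sym. Qed.

Lemma root_mx_borel (i j : 'I_N) : (i < j)%N -> root_mx F i j \in so_borel F l.
Proof.
move=> ij; rewrite mem_so_borel root_mx_so /=; apply/uptriP => a b ba.
have /uptriP/(_ a b ba) := root_elt_uptri (1 : F) ij.
by rewrite /root_elt scale1r mxE [1%:M a b]mxE -val_eqE /= gtn_eqF // add0r.
Qed.

Lemma root_mx_mulE i j n a c :
  (root_mx F i j *m n) a c = (a == i)%:R * n j c - (a == rev_ord j)%:R * n (rev_ord i) c.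
Proof.
have := root_eltE n i j 1 a c; rewrite /root_elt mulmxDl mul1mx mxE scale1r mul1r.
by move/addrI.
Qed.

(* The vectors n e_k with k <= j span a flag stable under the upper triangular
   algebra; suitable root vectors then force the entries below the diagonal to vanish. *)
Lemma normalizer_col n : n \in unitmx -> Ad n (so_borel F l) = so_borel F l ->
  forall i j : 'I_N, (j < l.-1)%N -> (j < i)%N -> n i j = 0.
Proof.
move=> un nb i j; have [m] := ubnP j; elim: m i j => // m IHm i j jm jl ji.
apply/eqP; apply/negPn/negP => nij.
(* Y n e_j = n X e_j with X triangular, and the n e_k with k < j vanish from row j on by
   induction. *)
have eig Y : Y \in so_borel F l ->
    exists c, forall a : 'I_N, (j <= a)%N -> (Y *m n) a j = c * n a j.
  rewrite -nb => /AdP[X Xb ->]; exists (X j j) => a ja.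
  rewrite mulmxKV // mxE (bigD1 j) //= mulrC big1 ?addr0 // => k kj.
  have [jk|kj'] := ltnP j k.
    by move: Xb; rewrite mem_so_borel => /andP[_ /uptriP->]; rewrite ?mulr0.
  have {kj'} kj' : (k < j)%N by rewrite ltn_neqAle kj' andbT (inj_eq val_inj).
  rewrite IHm ?mul0r //; first exact: leq_trans kj' _.
    exact: ltn_trans kj' jl.
  exact: leq_trans kj' ja.
case: (@arg_maxnP _ i (fun i => n i j != 0) (@nat_of_ord N) nij) => p np max_p.
have jp : (j < p)%N by apply: leq_trans ji _; apply: (max_p i).
have pj : (p == j) = false by rewrite -val_eqE /= gtn_eqF.
have jrj : (j < rev_ord j)%N by move: jl => /=; lia.
have jrj' : (j == rev_ord j) = false by rewrite -val_eqE /= ltn_eqF.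
(* Here the root vector from p to j is zero; the detour through j + 1 needs j + 1 < [rev_ord j],
   that is, j < l - 1. *)
have [prj|prj] := eqVneq p (rev_ord j).
  have j1N : (j.+1 < N)%N by move: jl; lia.
  pose j1 : 'I_N := Ordinal j1N.
  have j1r : (j1 < rev_ord j)%N by move: jl => /=; lia.
  have [c cP] := eig _ (root_mx_borel j1r).
  have := cP p (ltnW jp); rewrite root_mx_mulE rev_ordK pj mul0r subr0.
  rewrite prj -[_ == j1]val_eqE /= gtn_eqF // mul0r -prj.
  move=> /esym/eqP; rewrite mulf_eq0 (negPf np) orbF => /eqP c0.
  have := cP j1 (leqnSn _); rewrite root_mx_mulE eqxx mul1r rev_ordK c0 mul0r.
  rewrite (_ : (j1 == j) = false) ?mul0r ?subr0 -?prj; last by rewrite -val_eqE /= gtn_eqF.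
  by move/eqP; rewrite (negPf np).
have [c cP] := eig _ (root_mx_borel jp).
have := cP p (ltnW jp); rewrite root_mx_mulE pj mul0r.
rewrite eq_sym (negPf (rev_ord_neq p)) mul0r subr0.
move=> /esym/eqP; rewrite mulf_eq0 (negPf np) orbF => /eqP c0.
have := cP j (leqnn _); rewrite root_mx_mulE eqxx mul1r c0 mul0r.
rewrite (_ : (j == rev_ord p) = false) ?mul0r ?subr0; last first.
  by apply: contraNF prj => /eqP->; rewrite rev_ordK.
by move/eqP; rewrite (negPf np).
Qed.

Lemma normalizer_orthV n : orth n -> Ad n (so_borel F l) = so_borel F l ->
  Ad (invmx n) (so_borel F l) = so_borel F l.
Proof. by move=> on nb; rewrite -{1}nb AdK ?orth_unit. Qed.

(** [normalizer_col] for n and, reflected, for its inverse leaves a single position below the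
    diagonal, in the middle 2 x 2 block. *)
Lemma normalizer_below n (i j : 'I_N) : orth n -> Ad n (so_borel F l) = so_borel F l ->
  (j < i)%N -> (j, i) != (pos_l, neg_l) -> n i j = 0.
Proof.
move=> on nb ji ne; have un := orth_unit on.
have [jl|lj] := ltnP j l.-1; first exact: (normalizer_col un nb).
have [il|li] := ltnP (rev_ord i) l.-1.
  have := normalizer_col (orth_unit (orthV on)) (normalizer_orthV on nb) il.
  by move/(_ (rev_ord j)); rewrite ltn_rev_ord orth_invmxE // !rev_ordK; apply.
have li' : (i <= neg_l)%N by rewrite -leq_rev_ord rev_neg_l.
case/negP: ne; rewrite xpair_eqE.
have [|je] := between_pos_neg_l lj (ltnW (leq_trans ji li')); last first.
  by move: ji; rewrite je ltnNge li'.
have [ie|->->] := between_pos_neg_l (leq_trans lj (ltnW ji)) li'; last by rewrite !eqxx.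
by move=> je; move: ji; rewrite je ie ltnn.
Qed.

Lemma normalizer_diag n i : orth n -> Ad n (so_borel F l) = so_borel F l ->
  i != pos_l -> i != neg_l -> n i i != 0.
Proof.
move=> on nb; have un := orth_unit on.
have diag (k : 'I_N) : (k < l.-1)%N -> invmx n k k * n k k = 1.
  move=> kl; have : (invmx n *m n) k k = 1 by rewrite mulVmx // mxE eqxx.
  rewrite mxE (bigD1 k) //= big1 ?addr0 // => a; rewrite -val_eqE /= neq_ltn => /orP[ak|ka].
    rewrite (normalizer_col (orth_unit (orthV on)) (normalizer_orthV on nb)) ?mul0r //.
    exact: ltn_trans ak kl.
  by rewrite (normalizer_col un nb) ?mulr0.
have [il _ _|li i1 i2] := ltnP i l.-1.
  by have := diag i il; apply: contra_eqN => /eqP->; rewrite mulr0 eq_sym oner_eq0.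
have [ril|rli] := ltnP (rev_ord i) l.-1.
  have := diag _ ril; rewrite orth_invmxE // rev_ordK.
  by apply: contra_eqN => /eqP->; rewrite mul0r eq_sym oner_eq0.
have li' : (i <= neg_l)%N by rewrite -leq_rev_ord rev_neg_l.
by have [/eqP|/eqP] := between_pos_neg_l li li'; rewrite ?(negPf i1) ?(negPf i2).
Qed.

(** The middle block preserves a hyperbolic plane, so it is diagonal or antidiagonal. *)
Lemma normalizer_orth n : orth n -> Ad n (so_borel F l) = so_borel F l ->
  is_trig_mx n^T \/ forall i, n i (mid_swap i) != 0.
Proof.
move=> on nb.
have [n21|n21] := eqVneq (n neg_l pos_l) 0; [left|right].
  apply/uptriP => i j ji; have [[-> ->]//|ne] := eqVneq (j, i) (pos_l, neg_l).
  exact: normalizer_below.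
have below1 (k : 'I_N) : (neg_l < k)%N -> n k pos_l = 0.
  move=> k2; apply: normalizer_below => //; first exact: ltn_trans pos_l_lt_neg_l k2.
  by rewrite xpair_eqE eqxx -val_eqE gtn_eqF.
have below2 (k : 'I_N) : (neg_l < k)%N -> n k neg_l = 0.
  move=> k2; apply: normalizer_below => //.
  by rewrite xpair_eqE (negPf neg_l_neq_pos_l).
have pair_sum (j : 'I_N) : j = pos_l \/ j = neg_l ->
    \sum_k n (rev_ord k) pos_l * n k j = n neg_l pos_l * n pos_l j + n pos_l pos_l * n neg_l j.
  move=> j12; have belowj (k : 'I_N) : (neg_l < k)%N -> n k j = 0.
    by case: j12 => ->; [apply: below1|apply: below2].
  rewrite (bigD1 pos_l) //= (bigD1 neg_l) ?neg_l_neq_pos_l //= rev_neg_l -/neg_l.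
  rewrite big1 ?addr0 // => k.
  case/andP => k1 k2; have [mk|km] := ltnP neg_l k; first by rewrite belowj ?mulr0.
  rewrite below1 ?mul0r // -ltn_rev_ord rev_ordK rev_neg_l ltnNge; apply/negP => mk.
  by have [/eqP|/eqP] := between_pos_neg_l mk km; rewrite ?(negPf k1) ?(negPf k2).
have n11 : n pos_l pos_l = 0.
  have := orth_col pos_l pos_l on; rewrite pair_sum; last by left.
  rewrite eq_sym (negPf (rev_ord_neq _)) mulrC -mulr2n => /eqP.
  by rewrite mulrn_eq0 /= mulf_eq0 (negPf n21) orbF => /eqP.
have n12 : n pos_l neg_l != 0.
  have := orth_col pos_l neg_l on; rewrite eqxx pair_sum; last by right.
  rewrite n11 mul0r addr0; apply: contra_eqN => /eqP->.
  by rewrite mulr0 eq_sym oner_eq0.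
move=> i; have [->|i1] := eqVneq i pos_l; first by rewrite tpermL.
have [->|i2] := eqVneq i neg_l; first by rewrite tpermR.
by rewrite mid_swapP // normalizer_diag.
Qed.

(** The indices l - 1 and l are adjacent: exchanging them reverses the order of this pair only. *)
Lemma mid_swap_lt (i j : 'I_N) : (j < i)%N -> (j, i) != (pos_l, neg_l) ->
  (mid_swap j < mid_swap i)%N.
Proof.
move=> ji ne.
have [jm|jm] := eqVneq j pos_l.
  rewrite jm tpermL; have im1 : i != pos_l by rewrite -val_eqE -jm /= gtn_eqF.
  have im2 : i != neg_l by move: ne; rewrite jm xpair_eqE eqxx.
  rewrite mid_swapP // ltnNge; apply/negP => im.
  have mi : (pos_l <= i)%N by rewrite ltnW // -jm.
  by have [/eqP|/eqP] := between_pos_neg_l mi im; rewrite ?(negPf im1) ?(negPf im2).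
have [jm'|jm'] := eqVneq j neg_l.
  have i2 : (neg_l < i)%N by rewrite -jm'.
  rewrite jm' tpermR mid_swapP; first exact: ltn_trans pos_l_lt_neg_l i2.
    by rewrite -val_eqE gtn_eqF // (ltn_trans pos_l_lt_neg_l).
  by rewrite -val_eqE gtn_eqF.
rewrite (mid_swapP jm jm').
have [im1|im1] := eqVneq i pos_l.
  by rewrite im1 tpermL; apply: ltn_trans pos_l_lt_neg_l; rewrite -im1.
have [im2|im2] := eqVneq i neg_l; last by rewrite mid_swapP.
rewrite im2 tpermR ltnNge; apply/negP => mj.
have jm2 : (j <= neg_l)%N by rewrite ltnW // -im2.
by have [/eqP|/eqP] := between_pos_neg_l mj jm2; rewrite ?(negPf jm) ?(negPf jm').
Qed.

(** The only entry carried from above to below the diagonal is at ([pos_l], [neg_l]); it lies on the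
    antidiagonal, where so(2l) has zeros. *)
Lemma mid_swap_borel : Ad (perm_mx mid_swap) (so_borel F l) = so_borel F l.
Proof.
have os := perm_mx_orth F mid_swap_rev; have us := orth_unit os.
suff le : (Ad (perm_mx mid_swap) (so_borel F l) <= so_borel F l)%VS.
  by apply/eqP; rewrite eqEdim le dim_Ad /=.
apply/subvP => _ /AdP[A Ab ->]; rewrite mem_so_borel; move: Ab; rewrite mem_so_borel.
move=> /andP[As /uptriP At]; rewrite -(Ad_so_even os).
apply/andP; split; first by apply/AdP; exists A.
apply/uptriP => i j ji.
rewrite invmx_perm -col_permE -row_permE !mxE.
have A12 : A pos_l neg_l = 0.
  have /so_evenP/(_ neg_l pos_l) := As; rewrite rev_neg_l -/neg_l => /eqP.
  by rewrite -addr_eq0 -mulr2n mulrn_eq0 /= => /eqP.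
have [[-> ->]|ne] := eqVneq (j, i) (pos_l, neg_l); first by rewrite tpermL tpermR.
exact/At/mid_swap_lt.
Qed.

Lemma perm_conjE n (s t : {perm 'I_N}) i j :
  (perm_mx s *m n *m invmx (perm_mx t)) i j = n (s i) (t j).
Proof. by rewrite invmx_perm -col_permE -row_permE !mxE. Qed.

(** The quotient n normalizes [so_borel]. Where n is nonzero at all (a, f a), triangularity of b
    gives t^-1 a <= s^-1 (f a) for all a, and an inequality between permutations is an equality. The
    condition on b in the first case says b is in w B w^-1. *)
Lemma bruhat_unique b (s t : {perm 'I_N}) : orth b -> is_trig_mx b^T ->
    (forall i, s (rev_ord i) = rev_ord (s i)) ->
    (forall i, t (rev_ord i) = rev_ord (t i)) ->
    Ad (b *m perm_mx s) (so_borel F l) = Ad (perm_mx t) (so_borel F l) ->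
  (s = t /\ forall i j, (s j < s i)%N -> b i j = 0) \/ t = (s * mid_swap)%g.
Proof.
move=> ob bt sr tr bst.
have os := perm_mx_orth F sr; have ot := perm_mx_orth F tr.
pose n := invmx (perm_mx t) *m (b *m perm_mx s).
have on : orth n by apply: orthM; [apply: orthV|apply: orthM].
have nb : Ad n (so_borel F l) = so_borel F l.
  rewrite Ad_mul ?unitmx_inv ?unitmx_mul ?orth_unit //.
  by rewrite bst AdK ?orth_unit.
have bE i j : b i j = n (t i) (s j).
  rewrite -perm_conjE /n mulKVmx ?orth_unit // mulmxK ?orth_unit //.
move/uptriP: (bt) => bt'.
have le_t (f : {perm 'I_N}) : (forall a, n a (f a) != 0) -> t^-1%g = (f * s^-1)%g.
  move=> nf; apply: perm_le_eq => a; rewrite permM leqNgt.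
  by apply: contra (nf a) => /bt'; rewrite bE !permKV => ->.
have [nt|nm] := normalizer_orth on nb; [left|right].
  have st : s = t.
    apply: invg_inj; rewrite (le_t 1%g) ?mul1g // => a; rewrite perm1.
    have := orth_uptri_diag a on nt; apply: contra_eqN => /eqP->.
    by rewrite mul0r eq_sym oner_eq0.
  by split=> // i j ij; rewrite bE st; move/uptriP: nt; apply; rewrite -st.
by rewrite -[LHS]invgK (le_t _ nm) invMg invgK tpermV.
Qed.

End Normalizer.

(** * Antichain representatives *)

Section Reduction.
Variables (F : numFieldType) (l : nat) (l_gt0 : (0 < l)%N).
Local Notation N := l.*2.
Local Notation J := (so_form F l).
Local Notation pos_l := (pos_l l_gt0).
Local Notation neg_l := (neg_l l_gt0).
Implicit Types b : 'M[F]_N.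
Implicit Types (s : {perm 'I_N}) (A : {set 'I_N}).

(** Triangularity after reordering by s: for orthogonal b and equivariant s, membership in w B
    w^-1. *)
Definition compat s b := forall i j, (s j < s i)%N -> b i j = 0.

Lemma compatM s a b : compat s a -> compat s b -> compat s (a *m b).
Proof.
move=> sa sb i j ji; rewrite mxE big1 // => k _.
have [ki|ik] := ltnP (s k) (s i); first by rewrite sa ?mul0r.
by rewrite sb ?mulr0 //; apply: leq_trans ji ik.
Qed.

Lemma compatV s b : (forall i, s (rev_ord i) = rev_ord (s i)) -> orth b ->
  compat s b -> compat s (invmx b).
Proof. by move=> sr ob sb i j ji; rewrite orth_invmxE // sb // !sr ltn_rev_ord. Qed.

Lemma compat1 s : compat s 1%:M.
Proof.
move=> i j ji; rewrite mxE; case: eqP => // ij; by move: ji; rewrite ij ltnn.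
Qed.

Lemma compat_root s i j c : (forall i, s (rev_ord i) = rev_ord (s i)) ->
  (s i < s j)%N -> compat s (root_elt i j c).
Proof.
move=> sr ij a b ba; rewrite mxE (@compat1 s a b ba) mxE root_mxE add0r.
have -> : (a == i) && (b == j) = false.
  by apply/negP => /andP[/eqP ai /eqP bj]; move: ba; rewrite ai bj ltnNge ltnW.
have -> : (a == rev_ord j) && (b == rev_ord i) = false.
  apply/negP => /andP[/eqP ai /eqP bj]; move: ba.
  by rewrite ai bj !sr ltn_rev_ord ltnNge ltnW.
by rewrite subrr mulr0.
Qed.

Definition antichain_vector (A : {set 'I_N}) : 'cV[F]_N :=
  \col_i ((i \in A)%:R + (i == pos_l)%:R - (i == neg_l)%:R).

Lemma antichain_vector0 : antichain_vector finset.set0 = SO_odd_vector F l.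
Proof.
apply/colP => i; rewrite !mxE finset.inE add0r -!val_eqE.
by rewrite -[val neg_l]/(nat_of_ord neg_l) neg_lE.
Qed.

(* A is an antichain for the order [i <= j and s i <= s j], and stays one after
   adding the indices of e_l and e_(-l). *)
Definition antichain s (A : {set 'I_N}) : bool :=
  [forall i in A, (i < pos_l)%N &&
    [forall j, (j \in A) || (j == pos_l) || (j == neg_l) ==> (i < j)%N ==> (s j < s i)%N]].

Lemma antichainP s A : reflect
  ((forall i, i \in A -> (i < pos_l)%N) /\ (forall i j : 'I_N, i \in A ->
     [|| j \in A, j == pos_l | j == neg_l] -> (i < j)%N -> (s j < s i)%N))
  (antichain s A).
Proof.
apply: (iffP forall_inP) => [H|[H1 H2] i iA].
  split=> [i /H /andP[]//|i j /H /andP[_ /forallP/(_ j) /implyP H'] jA ij].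
  by move: (H'); rewrite -orbA => /(_ jA) /implyP; apply.
rewrite H1 //=; apply/forallP => j; rewrite -orbA; apply/implyP => jA; apply/implyP.
exact: H2.
Qed.

(** The first l entries scale the nonzero coordinates of x to 1, the others are forced to be
    inverses of the opposite ones. The coordinate at [neg_l] is thus multiplied by the one at
    [pos_l], when nonzero, which gives the -1 of the normal form. *)
Definition torus_elt (x : 'cV[F]_N) : 'rV[F]_N := \row_i
  (if (i < l)%N then (if x i 0 == 0 then 1 else (x i 0)^-1)
   else if x (rev_ord i) 0 == 0 then 1 else x (rev_ord i) 0).

Lemma rev_lt (i : 'I_N) : (rev_ord i < l)%N = ~~ (i < l)%N.
Proof. by have := ltn_ord i; rewrite /=; lia. Qed.

Lemma torus_elt_rev x i : torus_elt x 0 (rev_ord i) * torus_elt x 0 i = 1.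
Proof.
rewrite !mxE rev_lt rev_ordK.
by case: (i < l)%N => /=; case: eqP => /eqP x0; rewrite ?mulr1 ?mulfV ?mulVf.
Qed.

Lemma torus_orth x : orth (diag_mx (torus_elt x)).
Proof.
apply/matrixP => i j; rewrite tr_diag_mx mul_mx_diag mxE mul_diag_mx !mxE.
have [->|ji] := eqVneq j (rev_ord i); last by rewrite mulr0 mul0r.
by rewrite mulr1 -[RHS](torus_elt_rev x i) mulrC !mxE.
Qed.

Lemma torus_compat x s : compat s (diag_mx (torus_elt x)).
Proof.
move=> i j ji; rewrite mxE; case: eqP => [ij|]; last by rewrite mulr0n.
by move: ji; rewrite ij ltnn.
Qed.

Lemma compat1_uptri b : compat 1%g b -> is_trig_mx b^T.
Proof. by move=> cb; apply/uptriP => i j ji; apply: cb; rewrite !perm1. Qed.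

(* Root elements kill the entries of x that are not maximal in its support; the
   torus then normalizes the remaining ones. *)
Lemma reduce_vector s (x : 'cV[F]_N) : (forall i, s (rev_ord i) = rev_ord (s i)) ->
    (forall i : 'I_N, (neg_l < i)%N -> x i 0 = 0) -> x pos_l 0 * x neg_l 0 = -1 ->
  exists c A, [/\ orth c, is_trig_mx c^T, compat s c, antichain s A
    & c *m x = antichain_vector A].
Proof.
move=> sr.
pose S (y : 'cV[F]_N) : {set 'I_N} := [set i : 'I_N | (i < pos_l)%N && (y i 0 != 0)]%SET.
have [d] := ubnP #|S x|; elim: d x => // d IHd x Sx xgt x12.
have x1 : x pos_l 0 != 0.
  by apply: contra_eq_neq x12 => ->; rewrite mul0r eq_sym oppr_eq0 oner_eq0.
have x2 : x neg_l 0 != 0.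
  by apply: contra_eq_neq x12 => ->; rewrite mulr0 eq_sym oppr_eq0 oner_eq0.
have m12 := pos_l_lt_neg_l l_gt0.
have m12' : (pos_l == neg_l) = false by rewrite -val_eqE ltn_eqF.
have [aS|] := boolP (antichain s (S x)).
  exists (diag_mx (torus_elt x)), (S x); split=> //.
  - exact: torus_orth.
  - exact/compat1_uptri/torus_compat.
  - exact: torus_compat.
  apply/colP => i; rewrite mul_diag_mx !mxE finset.inE -le_pos_lE.
  have [->|i1] := eqVneq i pos_l.
    rewrite leqnn ltnn m12' (negPf x1) mulVf //.
    by rewrite add0r subr0.
  have [->|i2] := eqVneq i neg_l.
    rewrite leqNgt m12 /= rev_neg_l (negPf x1) x12 ltnNge ltnW //=.
    by rewrite !add0r.
  have [im|mi] := leqP i pos_l.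
    have -> : (i < pos_l)%N by rewrite ltn_neqAle im andbT (inj_eq val_inj).
    case: eqP => [->|/eqP xi]; rewrite ?mulr0 ?mulVf //= !addr0 subr0 //.
  rewrite ltnNge ltnW //= addr0 subr0.
  rewrite (xgt i) ?mulr0 // ltnNge; apply/negP => im.
  by have [/eqP|/eqP] := between_pos_neg_l (ltnW mi) im; rewrite ?(negPf i1) ?(negPf i2).
rewrite /antichain negb_forall => /existsP[i +]; rewrite negb_imply finset.inE.
case/andP=> /andP[im1 xi]; rewrite im1 /= negb_forall => /existsP[j +].
rewrite !negb_imply finset.inE -leqNgt => /and3P[jA ij sij].
have i1 : i != pos_l by rewrite -val_eqE ltn_eqF.
have i2 : i != neg_l by rewrite -val_eqE ltn_eqF // (ltn_trans im1).
have xj : x j 0 != 0 by case/orP: jA => [/orP[/andP[]//|/eqP->//]|/eqP->].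
have jm2 : (j <= neg_l)%N.
  case/orP: jA => [/orP[/andP[jm _]|/eqP->]|/eqP->//]; last exact: ltnW.
  exact: ltnW (ltn_trans jm m12).
have neq_ij : i != j by rewrite -val_eqE ltn_eqF.
have {}sij : (s i < s j)%N.
  by rewrite ltn_neqAle sij andbT (inj_eq val_inj) (inj_eq perm_inj).
(* Coordinate j clears coordinate i. The other row touched receives a multiple of x at [rev_ord i],
   zero since i < [pos_l], so the support only loses i. *)
pose c := - (x i 0 / x j 0); pose r := root_elt i j c.
have xri : x (rev_ord i) 0 = 0.
  by apply: xgt; rewrite ltn_rev_ord.
have rE a : (r *m x) a 0 = if a == i then 0 else x a 0.
  rewrite root_eltE xri mulr0 subr0; case: eqP => [->|_]; last by rewrite mul0r mulr0 addr0.
  by rewrite mul1r mulNr divfK // subrr.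
have Srx : S (r *m x) \proper S x.
  apply/properP; split; last first.
    by exists i; rewrite !finset.inE im1 ?xi // rE !eqxx.
  apply/fintype.subsetP => a; rewrite !finset.inE rE.
  by have [_|_ //] := eqVneq a i; rewrite eqxx andbF.
have [|a ma||t [A [ot tt tc aA tx]]] := IHd (r *m x).
- exact: leq_trans (proper_card Srx) _.
- by rewrite rE xgt // if_same.
- by rewrite !rE ![_ == i]eq_sym (negPf i1) (negPf i2).
exists (t *m r), A; split=> //.
- by apply: orthM => //; apply: root_elt_orth.
- by apply: uptriM => //; apply: root_elt_uptri.
- by apply: compatM => //; apply: compat_root.
by rewrite -mulmxA.
Qed.

Lemma antichain_vector_supp s A i : antichain s A ->
  antichain_vector A i 0 != 0 -> [|| i \in A, i == pos_l | i == neg_l].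
Proof.
rewrite mxE; case: (i \in A) => //=; case: (i == pos_l) => //=; case: (i == neg_l) => //=.
by rewrite addr0 subr0 eqxx.
Qed.

(** For i in A, the row i of b meets the support only on the diagonal: earlier entries vanish by
    triangularity, later ones by compatibility and the antichain condition. *)
Lemma antichain_sub s A A' b : orth b -> is_trig_mx b^T -> compat s b ->
  antichain s A -> b *m antichain_vector A = antichain_vector A' ->
  (A \subset A').
Proof.
move=> ob bt cb aA bA; have [A1 A2] := antichainP _ _ aA.
move/uptriP: (bt) => bt'.
apply/fintype.subsetP => i iA; have im := A1 i iA.
have i1 : (i == pos_l) = false by rewrite -val_eqE ltn_eqF.
have i2 : (i == neg_l) = false.
  by rewrite -val_eqE ltn_eqF // (ltn_trans im) // pos_l_lt_neg_l.
have : (b *m antichain_vector A) i 0 != 0.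
  rewrite mxE (bigD1 i) //= big1 ?addr0 => [|j ji].
    rewrite mxE iA i1 i2 addr0 subr0 mulr1.
    have := orth_uptri_diag i ob bt; apply: contra_eqN => /eqP->.
    by rewrite mul0r eq_sym oner_eq0.
  have [->|/(antichain_vector_supp aA) jA] := eqVneq (antichain_vector A j 0) 0.
    by rewrite mulr0.
  move: ji; rewrite -val_eqE /= neq_ltn => /orP[ji|ij]; first by rewrite bt' ?mul0r.
  by rewrite cb ?mul0r //; apply: A2.
by rewrite bA mxE i1 i2 addr0 subr0; case: (i \in A') => //; rewrite eqxx.
Qed.

Lemma antichain_unique s A A' b : (forall i, s (rev_ord i) = rev_ord (s i)) ->
  orth b -> is_trig_mx b^T -> compat s b -> antichain s A -> antichain s A' ->
  b *m antichain_vector A = antichain_vector A' -> A = A'.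
Proof.
move=> sr ob bt cb aA aA' bA; apply/eqP; rewrite finset.eqEsubset.
rewrite (antichain_sub ob bt cb aA bA) /=.
apply: (antichain_sub (orthV ob) (uptri_orthV ob bt) (compatV sr ob cb) aA').
by rewrite -bA mulKmx ?orth_unit.
Qed.

(** Reduction for s = 1 can only end at the empty antichain, as an i in A would satisfy both i <
    [pos_l] and [pos_l] < i. *)
Lemma antichain_vector_move (A : {set 'I_N}) : (forall i, i \in A -> (i < pos_l)%N) ->
  exists u, [/\ orth u, is_trig_mx u^T & u *m antichain_vector A = SO_odd_vector F l].
Proof.
move=> A1; have m12 := pos_l_lt_neg_l l_gt0; have m21 := negPf (neg_l_neq_pos_l l_gt0).
have A0 (i : 'I_N) : (pos_l <= i)%N -> (i \in A) = false.
  by move=> mi; apply/negbTE/negP => /A1; rewrite ltnNge mi.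
have [|||u [A' [ou ut _ aA' uA]]] := @reduce_vector 1%g (antichain_vector A).
- by move=> i; rewrite !perm1.
- move=> i mi; have mi1 : (pos_l < i)%N := ltn_trans m12 mi.
  rewrite mxE (A0 _ (ltnW mi1)) -!val_eqE (gtn_eqF mi) (gtn_eqF mi1).
  by rewrite addr0 subr0.
- have m12' : (pos_l == neg_l) = false by rewrite -val_eqE ltn_eqF.
  rewrite !mxE (A0 _ (leqnn _)) (A0 _ (ltnW m12)) !eqxx m12' m21.
  by rewrite !add0r subr0 mul1r.
exists u; split=> //; rewrite uA -antichain_vector0; congr antichain_vector.
apply/eqP; rewrite -finset.subset0; apply/fintype.subsetP => i iA'.
have [B1 B2] := antichainP _ _ aA'.
have := B2 i pos_l iA'; rewrite eqxx orbT !perm1 => /(_ isT (B1 i iA')).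
by rewrite ltnNge ltnW // B1.
Qed.

End Reduction.

(** * Orbits *)

Lemma card_finset_II (T : finType) (D : {set T}) : ([set` D] #= `I_#|D|)%card.
Proof.
pose X : {fset T} := [fset x in enum D]%fset.
have XD : #|` X|%fset = #|D| by rewrite card_fseq undup_id ?enum_uniq // -cardE.
have -> : [set` D]%classic = [set` X]%classic.
  by apply/seteqP; split=> x /=; rewrite !inE /= mem_enum.
exact/card_eq_fsetP.
Qed.

Section Orbits.
Variables (C : numClosedFieldType) (l : nat) (l_gt0 : (0 < l)%N).
Local Notation N := l.*2.
Local Notation J := (so_form C l).
Local Notation pos_l := (pos_l l_gt0).
Local Notation neg_l := (neg_l l_gt0).
Local Notation b0 := (so_borel C l).
Local Notation v0 := (SO_odd_vector C l).
Local Notation avec := (antichain_vector C l_gt0).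
Implicit Types (g u : 'M[C]_N) (s t : {perm 'I_N}) (A : {set 'I_N}).

Lemma B_SO_oddP g :
  B_SO_odd C l g <-> [/\ orth g, is_trig_mx g^T & g *m v0 = v0].
Proof.
split=> [[[[og _] gv] gt]|[og gt gv]]; first by split.
by split=> //; split=> //; split=> //; apply: orth_uptri_det.
Qed.

(** When nonempty, a coset on which [B_SO_odd] acts simply transitively from the left; this turns
    orbits on B / (B n w B w^-1) into orbits of B n w B w^-1 on B v. *)
Definition movers A : set 'M[C]_N :=
  [set u | [/\ orth u, is_trig_mx u^T & u *m avec A = v0]]%classic.

Definition orbit_of s A : set {vspace 'M[C]_N} :=
  [set Ad (u *m perm_mx s) b0 | u in movers A]%classic.

Definition rev_equivariant s := [forall i, s (rev_ord i) == rev_ord (s i)].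

Lemma rev_equivariantP s :
  reflect (forall i, s (rev_ord i) = rev_ord (s i)) (rev_equivariant s).
Proof. by apply: (iffP forallP) => H i; apply/eqP/H. Qed.

Lemma orbit_ofE s A u : rev_equivariant s -> movers A u ->
  Ad_orbit (B_SO_odd C l) (Ad (u *m perm_mx s) b0) = orbit_of s A.
Proof.
move=> /rev_equivariantP sr [ou ut uA].
have us := orth_unit (perm_mx_orth C sr); have uu := orth_unit ou.
apply/seteqP; split=> [_ [h /B_SO_oddP[oh ht hv] <-]|_ [w [ow wt wA] <-]].
  exists (h *m u); last by rewrite -mulmxA Ad_mul ?unitmx_mul ?uu ?us ?orth_unit.
  by split; [apply: orthM|apply: uptriM|rewrite -mulmxA uA].
exists (w *m invmx u).
  apply/B_SO_oddP; split; [exact/orthM/orthV|exact/uptriM/uptri_orthV|].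
  by rewrite -{1}uA -mulmxA mulKmx.
by rewrite -Ad_mul ?unitmx_mul ?unitmx_inv ?uu ?us ?orth_unit // mulmxA mulmxKV.
Qed.

Lemma movers_exist s A : antichain l_gt0 s A -> exists u, movers A u.
Proof.
by move=> /antichainP[A1 _]; have [u ?] := antichain_vector_move C A1; exists u.
Qed.

Lemma compat_Ad s u : rev_equivariant s -> orth u -> compat s u ->
  Ad (u *m perm_mx s) b0 = Ad (perm_mx s) b0.
Proof.
move=> /rev_equivariantP sr ou cu; have os := perm_mx_orth C sr.
have us := orth_unit os.
pose q := invmx (perm_mx s) *m u *m perm_mx s.
have oq : orth q by do 2![apply: orthM => //]; apply: orthV.
have -> : u *m perm_mx s = perm_mx s *m q by rewrite /q -mulmxA (mulKVmx us).
rewrite Ad_mul ?orth_unit // Ad_so_borel //; apply/uptriP => i j ji.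
have -> : q i j = u (s^-1%g i) (s^-1%g j).
  by rewrite /q -perm_conjE !invmx_perm invgK.
by rewrite cu // !permKV.
Qed.

(** On such vectors the form sees only the middle plane, so triangular orthogonal elements preserve
    the product of the two middle coordinates. *)
Lemma form_support (x : 'cV[C]_N) : (forall i : 'I_N, (neg_l < i)%N -> x i 0 = 0) ->
  (x^T *m J *m x) 0 0 = x pos_l 0 * x neg_l 0 *+ 2.
Proof.
move=> x0; rewrite isotropicE (bigD1 pos_l) //= (bigD1 neg_l) ?neg_l_neq_pos_l //=.
rewrite -/neg_l rev_neg_l.
rewrite big1 ?addr0 => [|k /andP[k1 k2]]; first by rewrite mulrC mulr2n.
have [mk|km] := ltnP neg_l k; first by rewrite (x0 k) ?mulr0.
rewrite x0 ?mul0r // -ltn_rev_ord rev_ordK rev_neg_l ltnNge; apply/negP => mk.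
by have [/eqP|/eqP] := between_pos_neg_l mk km; rewrite ?(negPf k1) ?(negPf k2).
Qed.

(** In g = b w b' the factor b' fixes [so_borel]. Reducing b^-1 v by c in B n w B w^-1 gives A, and
    b c^-1 replaces b without changing the subalgebra. *)
Lemma orbit_exists g : orth g -> exists s A,
  [/\ rev_equivariant s, antichain l_gt0 s A
    & Ad_orbit (B_SO_odd C l) (Ad g b0) = orbit_of s A].
Proof.
move=> /bruhat[b [b' [s [[ob bt] [ob' bt'] sr ->]]]].
have sre : rev_equivariant s by apply/rev_equivariantP.
have ub := orth_unit ob; have ubV := orthV ob; have us := orth_unit (perm_mx_orth C sr).
have vE i : v0 i 0 = (i == pos_l)%:R - (i == neg_l)%:R.
  by rewrite -antichain_vector0 mxE finset.inE add0r.
have v_supp (i : 'I_N) : (neg_l < i)%N -> v0 i 0 = 0.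
  move=> mi; rewrite vE -!val_eqE (gtn_eqF mi) (gtn_eqF (ltn_trans (pos_l_lt_neg_l l_gt0) mi)).
  by rewrite subr0.
have x_supp (i : 'I_N) : (neg_l < i)%N -> (invmx b *m v0) i 0 = 0.
  move=> mi; rewrite mxE big1 // => j _; have [mj|jm] := ltnP neg_l j.
    by rewrite v_supp ?mulr0.
  have /uptriP-> := uptri_orthV ob bt; rewrite ?mul0r //.
  exact: leq_ltn_trans jm mi.
have x12 : (invmx b *m v0) pos_l 0 * (invmx b *m v0) neg_l 0 = -1.
  have := form_support x_supp.
  rewrite trmx_mul -!mulmxA (mulmxA J) (mulmxA _^T _ v0) (mulmxA _^T).
  rewrite ubV mulmxA form_support // !vE !eqxx eq_sym (negPf (neg_l_neq_pos_l _)) => /esym.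
  by rewrite sub0r subr0 mul1r => /eqP; rewrite -subr_eq0 -mulrnBl mulrn_eq0 /= subr_eq0 => /eqP.
have [c [A [oc ct cc aA cx]]] := reduce_vector sr x_supp x12.
have uc := orth_unit oc; exists s, A; split=> //.
pose u := b *m invmx c.
rewrite -(@orbit_ofE s A u) //; last first.
  split; [exact/orthM/orthV|exact/uptriM/uptri_orthV|].
  by rewrite /u -cx -mulmxA mulKmx // mulKVmx.
congr (Ad_orbit _ _); rewrite Ad_mul ?unitmx_mul ?ub ?us ?orth_unit // Ad_so_borel //.
rewrite /u -mulmxA !Ad_mul ?unitmx_mul ?unitmx_inv ?uc //.
congr (Ad b _); rewrite -Ad_mul ?unitmx_inv // compat_Ad //; first exact: orthV.
exact: compatV.
Qed.

Lemma orbit_of_mid_swap s A : rev_equivariant s ->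
  orbit_of (s * mid_swap l_gt0)%g A = orbit_of s A.
Proof.
move=> /rev_equivariantP sr; have us := orth_unit (perm_mx_orth C sr).
have um := orth_unit (perm_mx_orth C (mid_swap_rev l_gt0)).
apply/seteqP; split=> _ [u uA <-]; exists u => //; case: uA => ou _ _;
have uu := orth_unit ou;
by rewrite perm_mxM mulmxA (Ad_mul _ _ um) ?unitmx_mul ?uu // mid_swap_borel.
Qed.

Lemma orbit_of_inj s t A A' : rev_equivariant s -> rev_equivariant t ->
    antichain l_gt0 s A -> antichain l_gt0 t A' -> orbit_of s A = orbit_of t A' ->
  (s = t /\ A = A') \/ t = (s * mid_swap l_gt0)%g.
Proof.
move=> sre tre aA aA' st; have [u uA] := movers_exist aA.
have /rev_equivariantP sr := sre; have /rev_equivariantP tr := tre.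
have us := orth_unit (perm_mx_orth C sr); have ut := orth_unit (perm_mx_orth C tr).
have : orbit_of t A' (Ad (u *m perm_mx s) b0) by rewrite -st; exists u.
case: uA => ou utri uA [w [ow wtri wA] wu].
have uu := orth_unit ou; have uw := orth_unit ow.
pose b := invmx w *m u; have ob : orth b by apply: orthM => //; apply: orthV.
have bt : is_trig_mx b^T by apply: uptriM => //; apply: uptri_orthV.
have bst : Ad (b *m perm_mx s) b0 = Ad (perm_mx t) b0.
  rewrite /b -mulmxA Ad_mul ?unitmx_inv ?unitmx_mul ?uu //.
  by rewrite -wu Ad_mul // AdK.
have [[st' cb]|] := bruhat_unique l_gt0 ob bt sr tr bst; [left|by right].
split=> //; subst t; apply: (antichain_unique sr ob bt cb aA aA').
by rewrite /b -mulmxA uA -wA mulKmx.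
Qed.

(* s and s * mid_swap have the same orbits; the second condition selects one of them. *)
Definition orbit_data : {set {perm 'I_N} * {set 'I_N}} :=
  [set sA | [&& rev_equivariant sA.1, (sA.1^-1%g pos_l <= pos_l)%N
    & antichain l_gt0 sA.1 sA.2]]%SET.

(** Of the opposite indices s^-1 [pos_l] and s^-1 [neg_l] exactly one is in the first half, and the
    exchange permutes them. *)
Lemma mid_swap_le_pos_l s : rev_equivariant s ->
  ((s * mid_swap l_gt0)^-1%g pos_l <= pos_l)%N = ~~ (s^-1%g pos_l <= pos_l)%N.
Proof.
move=> /rev_equivariantP sr; rewrite invMg permM tpermV tpermL.
have -> : s^-1%g neg_l = rev_ord (s^-1%g pos_l).
  by apply: (@perm_inj _ s); rewrite sr !permKV.
by rewrite !le_pos_lE rev_lt.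
Qed.

Lemma rev_equivariant_mid s : rev_equivariant s -> rev_equivariant (s * mid_swap l_gt0)%g.
Proof.
by move=> /rev_equivariantP sr; apply/rev_equivariantP => i; rewrite !permM sr mid_swap_rev.
Qed.

(** s [pos_l] and s [neg_l] are opposite, so one of them is at least [neg_l], and s i exceeds
    both. *)
Lemma antichain_gt s A i : rev_equivariant s -> antichain l_gt0 s A -> i \in A ->
  (neg_l < s i)%N.
Proof.
move=> /rev_equivariantP sr /antichainP[A1 A2] iA.
have lt1 : (s pos_l < s i)%N by apply: A2; rewrite ?eqxx ?orbT // A1.
have lt2 : (s neg_l < s i)%N.
  by apply: A2; rewrite ?eqxx ?orbT // (ltn_trans (A1 _ iA)) // pos_l_lt_neg_l.
move: lt1 lt2; rewrite sr neg_lE /=; have := ltn_ord (s pos_l); lia.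
Qed.

Lemma antichain_mid_swap s A : rev_equivariant s -> antichain l_gt0 s A ->
  antichain l_gt0 (s * mid_swap l_gt0)%g A.
Proof.
move=> sre aA; have [A1 A2] := antichainP _ _ _ aA; apply/antichainP; split=> // i j iA jA ij.
have si := antichain_gt sre aA iA.
rewrite !permM; apply: mid_swap_lt; first exact: A2.
by rewrite xpair_eqE (_ : (s i == neg_l) = false) ?andbF // -val_eqE gtn_eqF.
Qed.

Theorem B_SO_odd_orbitsE :
  B_SO_odd_orbits C l = [set orbit_of sA.1 sA.2 | sA in [set` orbit_data]]%classic.
Proof.
apply/seteqP; split=> [_ [b bX <-]|_ [[s A] /= sAD <-]].
  move: bX; rewrite flag_varietyE => -[g og <-].
  have [s [A [sre aA ->]]] := orbit_exists og.
  have [sm|] := boolP (s^-1%g pos_l <= pos_l)%N.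
    by exists (s, A) => //=; rewrite finset.inE sre sm aA.
  rewrite -mid_swap_le_pos_l // => sm.
  exists (s * mid_swap l_gt0, A)%g => /=; last exact: orbit_of_mid_swap.
  by rewrite finset.inE /= rev_equivariant_mid // sm antichain_mid_swap.
move: sAD; rewrite finset.inE /= => /and3P[sre _ aA].
have [u uA] := movers_exist aA; rewrite -(orbit_ofE sre uA).
exists (Ad (u *m perm_mx s) b0) => //; rewrite flag_varietyE.
exists (u *m perm_mx s) => //; case: uA => ou _ _; apply: orthM => //.
by apply: perm_mx_orth; apply/rev_equivariantP.
Qed.

Lemma orbit_data_inj :
  {in orbit_data &, injective (fun sA => orbit_of sA.1 sA.2)}.
Proof.
move=> [s A] [t A']; rewrite !finset.inE /= => /and3P[sre sm aA] /and3P[tre tm aA'] st.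
have [[-> ->]//|te] := orbit_of_inj sre tre aA aA' st.
by move: tm; rewrite te mid_swap_le_pos_l // sm.
Qed.

Theorem finite_B_SO_odd_orbits : finite_set (B_SO_odd_orbits C l).
Proof. rewrite B_SO_odd_orbitsE; apply: finite_image; exact: finite_finset. Qed.

Theorem card_B_SO_odd_orbits : #|` fset_set (B_SO_odd_orbits C l)|%fset = #|orbit_data|.
Proof.
rewrite B_SO_odd_orbitsE; apply: card_fset_set.
apply: card_eq_trans (inj_card_eq _) _ => [x y|].
  by rewrite !inE /=; apply: orbit_data_inj.
exact: card_finset_II.
Qed.

End Orbits.

(** * Counting signed permutations and antichains *)

Section IncreasingPerm.
Variable n : nat.
Implicit Types (s t r : {perm 'I_n}) (B : {set 'I_n}).

Definition increasing_on B s : bool :=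
  [forall i in B, forall j in B, (i < j)%N ==> (s i < s j)%N].

Lemma increasing_onP B s : reflect
  (forall i j : 'I_n, i \in B -> j \in B -> (i < j)%N -> (s i < s j)%N) (increasing_on B s).
Proof.
apply: (iffP forall_inP) => [H i j iB jB|H i iB].
  by have /forall_inP/(_ j jB)/implyP := H i iB.
by apply/forall_inP => j jB; apply/implyP; apply: H.
Qed.

(** A least moved index i would have r i > i and be the image of some j > i, with i and j in B. *)
Lemma increasing_on_perm1 B r : perm_on B r -> increasing_on B r -> r = 1%g.
Proof.
move=> rB /increasing_onP inc; apply/permP => i; rewrite perm1.
have [m] := ubnP i; elim: m i => // m IHm i; rewrite ltnS => im.
have [iB|niB] := boolP (i \in B); last exact: (out_perm rB).
have [lt|gt|/val_inj//] := ltngtP (r i) i.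
  by apply: (@perm_inj _ r); apply: IHm; apply: leq_trans lt im.
pose j := (r^-1)%g i; have rj : r j = i by rewrite permKV.
have jB : j \in B by rewrite -(perm_closed _ rB) rj.
have [ji|ij|/val_inj ij] := ltngtP j i.
- by move: rj; rewrite IHm; [move=> ij; move: ji; rewrite ij ltnn|apply: leq_trans ji im].
- by have := inc i j iB jB ij; rewrite rj ltnNge ltnW.
by rewrite -[in LHS]ij.
Qed.

(** Rearrangement inequality: at a maximum of the weighted sum [phi] there is no inversion inside B,
    since undoing one would increase it. *)
Lemma increasing_on_sort B t : exists2 r, perm_on B r & increasing_on B (r * t)%g.
Proof.
pose phi r := (\sum_(i < n) i * (r * t)%g i)%N.
have [r rB max_r] := @arg_maxnP _ 1%g (fun r => perm_on B r) phi (perm_on1 B).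
exists r => //; apply/increasing_onP => i j iB jB ij; rewrite ltnNge; apply/negP => tji.
have neq : (r * t)%g i != (r * t)%g j by rewrite (inj_eq perm_inj) -val_eqE ltn_eqF.
have lt : ((r * t)%g j < (r * t)%g i)%N.
  by rewrite ltn_neqAle tji andbT eq_sym (inj_eq val_inj).
have swB : perm_on B (tperm i j * r)%g.
  apply: perm_onM rB; apply/fintype.subsetP => k; rewrite !inE.
  by case: tpermP => [->|->|]; rewrite ?eqxx // => _ _; rewrite eqxx.
have := max_r _ swB; rewrite /= leqNgt => /negP; apply.
rewrite /phi -mulgA; move: (r * t)%g lt => w lt.
have ji : j != i by rewrite -val_eqE gtn_eqF.
rewrite (bigD1 i) //= (bigD1 j) //= [X in (_ < X)%N](bigD1 i) //= [X in (_ < _ + X)%N](bigD1 j) //=.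
rewrite !permM tpermL tpermR (eq_bigr (fun k : 'I_n => (k * (tperm i j * w)%g k)%N)); last first.
  by move=> k /andP[ki kj]; rewrite permM tpermD // eq_sym.
rewrite !addnA ltn_add2r; move: lt ij.
by move: (nat_of_ord (w j)) (nat_of_ord (w i)) (nat_of_ord i) (nat_of_ord j); nia.
Qed.

(** Every permutation is r * s for exactly one r supported in B and one s increasing on B. *)
Lemma card_increasing_on B : (#|[set s | increasing_on B s]| * (#|B|)`! = n`!)%N.
Proof.
have <- : #|perm_on [set: 'I_n]%SET| = n`! by rewrite card_perm cardsT card_ord.
rewrite -card_perm.
pose f (x : {perm 'I_n} * {perm 'I_n}) := (x.2 * x.1)%g.
pose D := finset.setX [set s | increasing_on B s]%SET [set r | perm_on B r]%SET.
have -> : (#|[set s | increasing_on B s]| * #|perm_on B| = #|D|)%N.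
  by rewrite /D cardsX; congr (_ * _)%N; apply: eq_card => r; rewrite finset.inE.
have f_inj : {in D &, injective f}.
  move=> [s r] [s' r']; rewrite !finset.inE /= /f /= => /andP[sI rB] /andP[sI' rB'] e.
  pose k := (r^-1 * r')%g.
  have sE : s = (k * s')%g by rewrite /k -mulgA -e mulKg.
  have kB : perm_on B k by apply: perm_onM rB'; apply: perm_onV.
  clearbody k; have k1 : k = 1%g.
    apply: (increasing_on_perm1 kB); apply/increasing_onP => i j iB jB ij.
    have := increasing_onP _ _ sI i j iB jB ij; rewrite sE !permM => lt.
    rewrite ltnNge; apply/negP; rewrite leq_eqVlt => /predU1P[/val_inj e'|lt'].
      by move: lt; rewrite e' ltnn.
    have := increasing_onP _ _ sI' (k j) (k i); rewrite !(perm_closed _ kB) => /(_ jB iB lt').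
    by rewrite ltnNge ltnW.
  by move: sE e; rewrite k1 mul1g => -> /mulIg ->.
rewrite -(card_in_imset f_inj); apply: eq_card => t.
rewrite [RHS](_ : _ = true); last by apply/fintype.subsetP => i _; rewrite finset.inE.
have [r rB inc] := increasing_on_sort B t.
apply/imsetP; exists ((r * t)%g, (r^-1)%g); last by rewrite /f /= mulKg.
by rewrite !finset.inE /= inc perm_onV.
Qed.

End IncreasingPerm.

(** * Signed permutations as a permutation with a set of sign changes *)

Section SignedPermutations.
Variable l : nat.
Local Notation N := l.*2.
Implicit Types (a : 'I_l) (p : 'I_N) (s : {perm 'I_l}) (E : {set 'I_l}).

Fact half_proof a : (l + a < l.*2)%N.
Proof. by have := ltn_ord a; lia. Qed.

(* The index p : 'I_(l.*2) as a distance a to the middle and a side. *)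
Definition half a (e : bool) : 'I_N :=
  if e then Ordinal (half_proof a) else rev_ord (Ordinal (half_proof a)).

Fact fold_proof p : ((if (p < l)%N then l.-1 - p else p - l) < l)%N.
Proof. by have := ltn_ord p; case: ifP; lia. Qed.

Definition fold_ord p : 'I_l := Ordinal (fold_proof p).
Definition side p : bool := (l <= p)%N.

Lemma half_rev a e : rev_ord (half a e) = half a (~~ e).
Proof. by case: e; rewrite /half ?rev_ordK. Qed.

Lemma half_val a e : half a e = (if e then l + a else l.-1 - a)%N :> nat.
Proof. by case: e => //=; have := ltn_ord a; lia. Qed.

Lemma fold_ord_half a e : fold_ord (half a e) = a.
Proof.
apply: val_inj; rewrite /fold_ord /= half_val; have := ltn_ord a.
by case: e; case: ifP; lia.
Qed.

Lemma side_half a e : side (half a e) = e.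
Proof. by rewrite /side half_val; have := ltn_ord a; case: e; lia. Qed.

Lemma half_fold_ord p : half (fold_ord p) (side p) = p.
Proof.
apply: val_inj; rewrite [LHS]half_val /side /fold_ord /=; have := ltn_ord p.
by case: (ltnP p l); lia.
Qed.

Lemma half_inj a b e f : half a e = half b f -> a = b /\ e = f.
Proof.
by move=> ab; rewrite -(fold_ord_half a e) -{2}(side_half a e) ab fold_ord_half side_half.
Qed.

(** E records sign changes at the sources, not at the images. *)
Definition signed_fun s E p : 'I_N := half (s (fold_ord p)) (side p (+) (fold_ord p \in E)).

Lemma signed_fun_inj s E : injective (signed_fun s E).
Proof.
move=> p q /half_inj[/perm_inj pq]; rewrite pq => /addIb side_pq.
by rewrite -(half_fold_ord p) -(half_fold_ord q) pq side_pq.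
Qed.

Definition signed_perm s E : {perm 'I_N} := perm (@signed_fun_inj s E).

Lemma signed_permE s E a e : signed_perm s E (half a e) = half (s a) (e (+) (a \in E)).
Proof. by rewrite permE /signed_fun fold_ord_half side_half. Qed.

Lemma signed_perm_rev s E : rev_equivariant (signed_perm s E).
Proof.
apply/rev_equivariantP => p; rewrite -(half_fold_ord p) half_rev !signed_permE half_rev.
by rewrite addNb.
Qed.

Lemma signed_perm_surj (t : {perm 'I_N}) : rev_equivariant t ->
  exists s E, t = signed_perm s E.
Proof.
move=> /rev_equivariantP tr; pose f a := fold_ord (t (half a false)).
have f_inj : injective f.
  move=> a b ab; have : t (half a false) = t (half b false) \/ t (half a false) = t (half b true).
    rewrite -[true]/(~~ false) -half_rev tr -(half_fold_ord (t (half a _))).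
    rewrite -(half_fold_ord (t (half b _))) half_rev -/(f a) -/(f b) ab.
    by case: (side _); case: (side _); [left|right|right|left].
  by case=> /perm_inj/half_inj[].
exists (perm f_inj), [set a | side (t (half a false))]%SET.
apply/permP => p; rewrite -(half_fold_ord p) signed_permE permE finset.inE.
move: (fold_ord p) (side p) => a e; case: e; last by rewrite half_fold_ord.
by rewrite -[true]/(~~ false) -half_rev tr addTb -half_rev half_fold_ord.
Qed.

Lemma signed_perm_inj s s' E E' : signed_perm s E = signed_perm s' E' -> s = s' /\ E = E'.
Proof.
move=> e; have eq a : s a = s' a /\ (a \in E) = (a \in E').
  have := congr1 (fun t : {perm 'I_N} => t (half a false)) e.
  by rewrite !signed_permE => /half_inj.
by split; [apply/permP|apply/finset.setP] => a; have [] := eq a.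
Qed.

End SignedPermutations.

(** * Counting the orbit data *)

Section Counting.
Variable n : nat.
Local Notation l := n.+1.
Local Notation pos_l := (pos_l (ltn0Sn n)).
Local Notation neg_l := (neg_l (ltn0Sn n)).

Lemma half_pos_l : half ord0 false = pos_l :> 'I_(l.*2).
Proof. by apply: val_inj; rewrite [LHS]half_val /= subn0. Qed.

Lemma half_neg_l : half ord0 true = neg_l :> 'I_(l.*2).
Proof. by rewrite -[RHS]/(rev_ord pos_l) -half_pos_l half_rev. Qed.

(** [orbit_data] in coordinates: permutation of distances, sign changes, antichain. [ord0] stands
    for the middle pair; adding it to A gives the k + 1 of the count. *)
Definition signed_data : {set {perm 'I_l} * {set 'I_l} * {set 'I_l}} :=
  [set x : {perm 'I_l} * {set 'I_l} * {set 'I_l} |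
    [&& ord0 \notin x.2, increasing_on (ord0 |: x.2) x.1.1,
      x.2 \subset x.1.2 & (x.1.1^-1%g ord0) \notin x.1.2]]%SET.

Definition to_orbit_data (x : {perm 'I_l} * {set 'I_l} * {set 'I_l}) :
    {perm 'I_(l.*2)} * {set 'I_(l.*2)} :=
  (signed_perm x.1.1 x.1.2, (fun a => half a false) @: x.2)%SET.

Lemma half_false_lt (a b : 'I_l) : (half a false < half b false)%N = (b < a)%N.
Proof. by rewrite !half_val; have := ltn_ord a; have := ltn_ord b; lia. Qed.

Lemma half_false_inj : injective (fun a : 'I_l => half a false).
Proof. by move=> a b /half_inj[]. Qed.

Lemma half_true_lt (a b : 'I_l) : (half a true < half b true)%N = (a < b)%N.
Proof. by rewrite !half_val ltn_add2l. Qed.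

Lemma half_lt_true (a b : 'I_l) e : (a < b)%N -> (half a e < half b true)%N.
Proof. by rewrite !half_val; have := ltn_ord a; case: e; lia. Qed.

(** [half] reverses the order on the side [false], and [antichain_gt] forces a sign change on A, so
    the antichain condition becomes monotonicity of s. The comparisons with both middle indices say
    s 0 < s a. *)
Lemma antichain_signed s E (A : {set 'I_l}) :
  antichain (ltn0Sn n) (signed_perm s E) ((fun a => half a false) @: A)%SET =
  [&& ord0 \notin A, increasing_on (ord0 |: A)%SET s & A \subset E].
Proof.
have sre := signed_perm_rev s E; set t := signed_perm s E in sre *.
have tE a e : t (half a e) = half (s a) (e (+) (a \in E)) by apply: signed_permE.
have memA a : a \in A -> half a false \in ((fun a => half a false) @: A)%SET.
  by move=> aA; apply: imset_f.
have mem0 (a : 'I_l) : (half a false < pos_l)%N = (a != ord0).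
  by rewrite -half_pos_l half_false_lt lt0n.
apply/idP/and3P => [aA|[A0 /increasing_onP inc /fintype.subsetP AE]].
  have AE a : a \in A -> a \in E.
    move=> aA'; have := antichain_gt sre aA (memA a aA').
    by rewrite tE -half_neg_l !half_val; case: (a \in E) => //=; lia.
  have [A1 A2] := antichainP _ _ _ aA; split; last exact/fintype.subsetP.
    by apply/negP => /memA/A1; rewrite mem0 eqxx.
  apply/increasing_onP => a b; rewrite !finset.in_setU1 => a0A bA ab.
  have bA' : b \in A by case/predU1P: bA => // b0; move: ab; rewrite b0 ltn0.
  have lt : (t (half a false) < t (half b false))%N.
    apply: A2; [exact: memA| |by rewrite half_false_lt].
    case/predU1P: a0A => [->|/memA->//]; by rewrite half_pos_l eqxx orbT.
  case/predU1P: a0A => [a0|/AE aE]; last first.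
    by move: lt; rewrite !tE aE (AE b bA') half_true_lt.
  have := antichain_gt sre aA (memA b bA').
  have lt' : (t (half a true) < t (half b false))%N.
    apply: A2; [exact: memA| |].
      by rewrite a0 half_neg_l eqxx !orbT.
    by rewrite !half_val; have := ltn_ord b; lia.
  (* Whatever the sign at [ord0], one of the two middle indices goes to the side [true], and that
     one gives the comparison. *)
  move: lt lt' => + + _; rewrite !tE (AE b bA') /=.
  by case: (a \in E); rewrite /= ?half_true_lt // => _; rewrite half_true_lt.
apply/antichainP; split=> [_ /imsetP[a aA ->]|_ j /imsetP[a aA ->]].
  by rewrite mem0; apply: contraNneq A0 => <-.
have a_in : a \in (ord0 |: A)%SET by rewrite finset.in_setU1 aA orbT.
have a_gt0 : ((ord0 : 'I_l) < a)%N.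
  rewrite lt0n; apply: contraNneq A0 => a0.
  by rewrite (_ : ord0 = a) //; apply: val_inj; rewrite /= a0.
have lt0 : (s ord0 < s a)%N by apply: inc => //; rewrite finset.in_setU1 eqxx.
rewrite tE (AE a aA) addFb => /or3P[/imsetP[b bA ->]|/eqP->|/eqP->].
- rewrite half_false_lt tE (AE b bA) => ba; rewrite half_true_lt.
  by apply: inc => //; rewrite finset.in_setU1 bA orbT.
- by rewrite -half_pos_l tE => _; apply: half_lt_true.
by rewrite -half_neg_l tE => _; apply: half_lt_true.
Qed.

Lemma canonical_signed s E :
  ((signed_perm s E)^-1%g pos_l <= pos_l)%N = ((s^-1)%g (ord0 : 'I_l) \notin E).
Proof.
pose a := (s^-1)%g (ord0 : 'I_l).
have -> : (signed_perm s E)^-1%g pos_l = half a (a \in E).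
  apply: (@perm_inj _ (signed_perm s E)).
  by rewrite permKV signed_permE addbb /a permKV half_pos_l.
rewrite -/a half_val /=; have := ltn_ord a; case: (a \in E); lia.
Qed.

Lemma to_orbit_data_inj : injective to_orbit_data.
Proof.
move=> [[s E] A] [[s' E'] A'] [/signed_perm_inj[-> ->]].
by move/(imset_inj half_false_inj) => ->.
Qed.

Lemma card_orbit_data : #|orbit_data (ltn0Sn n)| = #|signed_data|.
Proof.
rewrite -(card_imset _ to_orbit_data_inj); apply: eq_card => -[t B].
apply/idP/imsetP => [|[[[s E] A] + [-> ->]]]; last first.
  rewrite !finset.inE /= signed_perm_rev antichain_signed canonical_signed.
  by case/and4P=> -> -> -> ->.
rewrite finset.inE /= => /and3P[tre tc aB].
have [s [E tE]] := signed_perm_surj tre.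
pose A := [set a : 'I_l | half a false \in B]%SET.
have BE : B = ((fun a => half a false) @: A)%SET.
  apply/finset.setP => p; apply/idP/imsetP => [pB|[a + ->]]; last by rewrite finset.inE.
  have pE : half (fold_ord p) false = p.
    have [A1 _] := antichainP _ _ _ aB.
    have sp : side p = false by have := A1 p pB; rewrite /side /=; lia.
    by rewrite -sp half_fold_ord.
  by exists (fold_ord p); rewrite ?finset.inE pE.
exists (s, E, A); last by rewrite /to_orbit_data /= -tE -BE.
rewrite finset.inE /=; move: tc aB; rewrite {1}tE BE canonical_signed tE antichain_signed.
by move=> -> /and3P[-> -> ->].
Qed.



Lemma card_between (T : finType) (A : {set T}) (z : T) : z \notin A ->
  #|[set E : {set T} | (A \subset E) && (z \notin E)]%SET| = (2 ^ (#|T|.-1 - #|A|))%N.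
Proof.
move=> zA; pose R := (~: (z |: A))%SET.
have f_inj : {in powerset R &, injective (fun E => A :|: E)%SET}.
  move=> E E'; rewrite !powersetE => ER ER' AE; apply/finset.setP => x.
  have /finset.setP/(_ x) := AE; rewrite !finset.in_setU.
  have [xA|//] := boolP (x \in A).
  have nR (D : {set T}) : (D \subset R) -> (x \in D) = false.
    by move=> /fintype.subsetP DR; apply/negP => /DR; rewrite !finset.inE xA orbT.
  by rewrite !nR.
have -> : [set E : {set T} | (A \subset E) && (z \notin E)]%SET =
    ((fun E => A :|: E) @: powerset R)%SET.
  apply/finset.setP => E; rewrite finset.inE; apply/andP/imsetP => [[AE zE]|[E0 + ->]].
    exists (E :\: A)%SET; last first.
      by apply/finset.setP => x; rewrite !finset.inE;
         case: (boolP (x \in A)) => // /(fintype.subsetP AE) ->.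
    rewrite powersetE; apply/fintype.subsetP => x; rewrite !finset.inE => /andP[xA xE].
    by rewrite negb_or xA andbT; apply: contraNneq zE => <-.
  rewrite powersetE => /fintype.subsetP ER; split; first exact: finset.subsetUl.
  by rewrite finset.in_setU negb_or zA /=; apply/negP => /ER; rewrite !finset.inE eqxx.
rewrite (card_in_imset f_inj) card_powerset; congr (2 ^ _)%N.
by have := cardsC (z |: A)%SET; rewrite cardsU1 zA -/R; lia.
Qed.

Lemma card_signed_data : #|signed_data| =
  (\sum_(A : {set 'I_l} | ord0 \notin A)
     #|[set s : {perm 'I_l} | increasing_on (ord0 |: A)%SET s]%SET| * 2 ^ (n - #|A|))%N.
Proof.
rewrite -sum1_card (partition_big (fun x => x.2)
  (fun A : {set 'I_l} => ord0 \notin A)) /=; last first.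
  by move=> x; rewrite finset.inE => /and4P[].
apply: eq_bigr => A A0.
rewrite (partition_big (fun x => x.1.1)
  (fun s : {perm 'I_l} => increasing_on (ord0 |: A)%SET s)) /=; last first.
  by move=> [[s E] A']; rewrite finset.inE /= => /andP[/and4P[_ inc _ _] /eqP <-].
rewrite -sum_nat_const [RHS](eq_bigl
  (fun s : {perm 'I_l} => increasing_on (ord0 |: A)%SET s)); last first.
  by move=> s; rewrite finset.inE.
apply: eq_bigr => s inc; rewrite sum1_card.
(* Otherwise s, increasing on [ord0] and A, would take at [ord0] a value below 0. So the sign fixed
   by the choice of representative is not among those forced by A. *)
have zA : s^-1%g ord0 \notin A.
  apply/negP => zA; have := increasing_onP _ _ inc ord0 (s^-1%g ord0).
  rewrite !finset.in_setU1 eqxx zA orbT permKV ltn0 => /(_ isT isT) lt.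
  have : ~~ ((ord0 : 'I_l) < s^-1%g ord0)%N by apply/negP => /lt.
  rewrite -leqNgt leqn0 => /eqP z0; case/negP: A0.
  by rewrite (_ : ord0 = s^-1%g ord0) //; apply: val_inj.
have := card_between zA; rewrite card_ord /= => <-.
have f_inj : injective (fun E : {set 'I_l} => (s, E, A)) by move=> E E' [].
rewrite -(card_imset _ f_inj); apply: eq_card => -[[s' E] A'].
rewrite [LHS](_ : _ = [&& ord0 \notin A', increasing_on (ord0 |: A')%SET s', A' \subset E,
   (s'^-1)%g ord0 \notin E, A' == A & s' == s]); last first.
  rewrite -[LHS]/(((s', E, A') \in signed_data) && (A' == A) && (s' == s)).
  by rewrite finset.inE /= -!andbA.
apply/idP/imsetP => [/and5P[_ _ AE zE /andP[/eqP eA /eqP es]]|[E' + [-> -> ->]]].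
  by exists E; rewrite ?finset.inE eA es // in AE zE *; rewrite AE zE.
by rewrite finset.inE A0 inc !eqxx => /andP[-> ->].
Qed.

(** Dividing by l! turns the number of increasing permutations into 1 / (k + 1)!, and 'C(n, k) sets
    of size k avoid [ord0]. *)
Lemma egf_signed_data : (#|signed_data|)%:R / (l`!)%:R =
  \sum_(k < l) ('C(n, k) * 2 ^ (n - k))%:R / (k.+1`!)%:R :> rat.
Proof.
have fact0 m : (m`!)%:R != 0 :> rat by rewrite pnatr_eq0 -lt0n fact_gt0.
rewrite card_signed_data natr_sum mulr_suml.
have cardA (A : {set 'I_l}) : ord0 \notin A -> (#|A| < l)%N.
  by move=> A0; have := max_card (mem (ord0 |: A)%SET); rewrite cardsU1 A0 card_ord add1n.
rewrite (eq_bigr (fun A : {set 'I_l} => (2 ^ (n - #|A|))%:R / ((#|A|.+1)`!)%:R : rat)); last first.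
  move=> A A0; have := card_increasing_on (ord0 |: A)%SET; rewrite cardsU1 A0 add1n.
  move=> /(congr1 (fun m => m%:R : rat)); rewrite natrM => e.
  rewrite natrM -e; field.
  by rewrite !fact0 /=; move: (fact0 l); rewrite -e mulf_eq0 negb_or => /andP[].
(* [inord] loses nothing: A avoids [ord0], so its size is below l. *)
rewrite (partition_big (fun A : {set 'I_l} => inord #|A| : 'I_l) xpredT) //=.
apply: eq_bigr => k _.
rewrite (eq_bigr (fun=> (2 ^ (n - k))%:R / (k.+1`!)%:R)); last first.
  by move=> A /andP[A0 /eqP <-]; rewrite inordK ?cardA.
rewrite sumr_const natrM -mulrA -[LHS]mulr_natl; congr (_%:R * _).
have := cards_draws [set~ ord0 : 'I_l]%SET k; rewrite cardsC1 card_ord /= => <-.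
apply: eq_card => A; rewrite finset.inE unfold_in /=.
have -> : (A \subset [set~ ord0]%SET) = (ord0 \notin A).
  by rewrite finset.subsetC finset.sub1set finset.inE.
case: (boolP (ord0 \notin A)) => //= A0.
by rewrite -val_eqE /= inordK ?cardA.
Qed.

End Counting.

(** * Generating functions *)

Section Series.

Lemma coef_fpsXM (b : fps) m : fps_coef (fpsX * b) m = if m is k.+1 then fps_coef b k else 0.
Proof.
rewrite -[fpsX * b]/(fps_mul fpsX b) /=; case: m => [|k].
  by rewrite big_ord1 mul0r.
rewrite big_ord_recl big_ord_recl /= mul0r add0r mul1r subn1 /=.
by rewrite big1 ?addr0 // => i _; rewrite mul0r.
Qed.

Lemma fps_coefD (a b : fps) m : fps_coef (a + b) m = fps_coef a m + fps_coef b m.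
Proof. by []. Qed.

Lemma fps_coefN (a : fps) m : fps_coef (- a) m = - fps_coef a m.
Proof. by []. Qed.

Lemma fps_coef_double (a : fps) m : fps_coef (2%:R * a) m = 2%:R * fps_coef a m.
Proof. by rewrite !mulr_natl !mulr2n. Qed.

Local Notation q := (fpsX / (1 - 2%:R * fpsX)).

Lemma geom_fpsK : q * (1 - 2%:R * fpsX) = fpsX.
Proof.
suff u : fps_coef (1 - 2%:R * fpsX) 0 != 0 by apply: divrK; exact: u.
by rewrite fps_coefD fps_coefN mulrC coef_fpsXM subr0 oner_eq0.
Qed.

(** Coefficients of q = X + 2 X q multiplied by q^k. *)
Lemma coef_geom_fps_rec k m : fps_coef (q ^+ k.+1) m =
  2%:R * (if m is i.+1 then fps_coef (q ^+ k.+1) i else 0) +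
  (if m is i.+1 then fps_coef (q ^+ k) i else 0).
Proof.
have e : q ^+ k.+1 = 2%:R * (fpsX * q ^+ k.+1) + fpsX * q ^+ k.
  have gen (a x : fps) : a * (1 - 2%:R * x) = x ->
      a ^+ k.+1 = 2%:R * (x * a ^+ k.+1) + x * a ^+ k.
    by move=> ax; rewrite -{2}ax exprS; ring.
  exact/gen/geom_fpsK.
by rewrite {1}e fps_coefD fps_coef_double !coef_fpsXM.
Qed.

Lemma coef_geom_fps0 k : fps_coef (q ^+ k) 0 = (k == 0%N)%:R.
Proof. by case: k => [|k] //; rewrite coef_geom_fps_rec mulr0 addr0. Qed.

Lemma coef_geom_fps k m : fps_coef (q ^+ k.+1) m.+1 = ('C(m, k) * 2 ^ (m - k))%:R.
Proof.
elim: m k => [|m IHm] k; rewrite coef_geom_fps_rec.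
  by rewrite !coef_geom_fps0 mulr0 add0r bin0n; case: k.
rewrite IHm; case: k => [|k].
  rewrite expr0 -[fps_coef 1 m.+1]/(0 : rat) addr0 !bin0 !mul1n !subn0 expnS natrM //.
rewrite IHm -natrM -natrD subSS binS mulnDl mulnCA -expnS; congr (_ + _)%:R.
(* For k >= m the truncated exponents differ, but the binomial coefficient is zero. *)
have [km|mk] := ltnP k m; first by rewrite -subSn // subSS.
by rewrite bin_small.
Qed.

Lemma coef_exp_geom_fps m : fps_coef (fps_exp q) m.+1 =
  \sum_(k < m.+1) ('C(m, k) * 2 ^ (m - k))%:R / (k.+1`!)%:R.
Proof.
rewrite [LHS]big_ord_recl (_ : fps_coef (q ^+ _) _ = 0) // mul0r add0r.
by apply: eq_bigr => k _; rewrite coef_geom_fps.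
Qed.

End Series.

Theorem proposition3p15 (R : realType) :
  (forall l : nat, (0 < l)%N -> finite_set (B_SO_odd_orbits R[i] l)) /\
  egf (nb_B_SO_odd_orbits R[i]) = fps_exp (fpsX / (1 - 2%:R * fpsX)).
Proof.
split=> [l l_gt0|]; first exact: finite_B_SO_odd_orbits.
apply/fpsP => -[|n].
  by rewrite /fps_exp [RHS]big_ord1.
rewrite coef_exp_geom_fps -egf_signed_data -card_orbit_data.
by rewrite -(card_B_SO_odd_orbits (R[i] : numClosedFieldType) (ltn0Sn n)).
Qed.
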